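(* Let $G$ and $H$ be countably infinite graphs which both have Hamilton decompositions. Then their Cartesian product $G\square H$ has a Hamilton decomposition.
   Context: A double-ray is an infinite, connected, 2-regular (sub)graph. A Hamiltonian double-ray of a graph is a double-ray contained in it as a subgraph that includes every vertex. An infinite graph has a Hamilton decomposition if its edge set can be partitioned into the edge sets of a nonempty (finite or infinite) family of edge-disjoint Hamiltonian double-rays. Graphs are not assumed to be locally finite. The Cartesian product $G\square H$ is the graph with vertex set $V(G)\times V(H)$ in which two vertices $(g,h)$ and $(g',h')$ are adjacent if and only if either $g=g'$ and $h$ is adjacent to $h'$ in $H$, or $h=h'$ and $g$ is adjacent to $g'$ in $G$. *)

(* Defs.v *)
From Stdlib Require Import Relation_Operators.
From mathcomp Require Import all_boot.
From mathcomp Require Import boolp classical_sets functions cardinality.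

Set Implicit Arguments.
Unset Strict Implicit.
Unset Printing Implicit Defensive.

Local Open Scope classical_set_scope.
Local Open Scope card_scope.

(* Simple graphs, of arbitrary cardinality and degrees, whose vertices form a
   subset of the ambient type T; thus a graph and its subgraphs have the same
   type. *)
Record graph (T : Type) := Graph {
  vertices : set T;
  adj : T -> T -> Prop;
  adj_vertices : forall x y, adj x y -> vertices x /\ vertices y;
  adj_sym : forall x y, adj x y -> adj y x;
  adj_irrefl : forall x, ~ adj x x
}.

Section Graphs.
Variable T : Type.
Implicit Types G D : graph T.

Definition edges G : set (set T) :=
  [set e | exists x y, adj G x y /\ e = [set x; y]].

Definition subgraph D G : Prop :=
  vertices D `<=` vertices G /\ edges D `<=` edges G.

Definition countably_infinite G : Prop := vertices G #= [set: nat].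

(* The steps of a walk automatically stay inside [vertices G], by
   [adj_vertices]. *)
Definition connected G : Prop :=
  forall x y, vertices G x -> vertices G y -> clos_refl_trans T (adj G) x y.

Definition regular (k : nat) G : Prop :=
  forall x, vertices G x -> [set y | adj G x y] #= `I_k.

Definition double_ray D : Prop :=
  [/\ infinite_set (vertices D), connected D & regular 2 D].

Definition hamiltonian_double_ray G D : Prop :=
  [/\ double_ray D, subgraph D G & vertices D = vertices G].

(* [partition F edges (edges G)]: the edge sets of the members of F cover
   edges G, are nonempty, and are disjoint for distinct members. *)
Definition has_hamilton_decomposition G : Prop :=
  exists F : set (graph T),
    [/\ F !=set0, F `<=` hamiltonian_double_ray G
      & partition F edges (edges G)].

End Graphs.

Section CartesianProduct.
Variables (T U : Type) (G : graph T) (H : graph U).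

Definition cart_vertices : set (T * U) := vertices G `*` vertices H.

(* The first conjunct of each case says that the common coordinate is a vertex
   of its factor, since T and U may have elements that are not vertices. *)
Definition cart_adj (p q : T * U) : Prop :=
  [/\ vertices G p.1, p.1 = q.1 & adj H p.2 q.2] \/
  [/\ vertices H p.2, p.2 = q.2 & adj G p.1 q.1].

Lemma cart_adj_vertices p q :
  cart_adj p q -> cart_vertices p /\ cart_vertices q.
Proof.
case: p q => [g h] [g' h'] [] [/= v <- a];
  by have [? ?] := adj_vertices a; split; split.
Qed.

Lemma cart_adj_sym p q : cart_adj p q -> cart_adj q p.
Proof.
case: p q => [g h] [g' h'] [] [/= v <- a]; [left|right];
  by split => //; exact: adj_sym.
Qed.

Lemma cart_adj_irrefl p : ~ cart_adj p p.
Proof. by case=> [] [_ _ a]; exact: adj_irrefl a. Qed.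

Definition cartesian_product : graph (T * U) :=
  Graph cart_adj_vertices cart_adj_sym cart_adj_irrefl.

End CartesianProduct.

(* Main.v *)
Require Import Defs.
From Stdlib Require Import ZArith Lia Relation_Operators.
From mathcomp Require Import all_boot zify.
From mathcomp Require Import boolp classical_sets functions cardinality.

Set Implicit Arguments.
Unset Strict Implicit.
Unset Printing Implicit Defensive.

Local Open Scope Z_scope.

(** Colour every edge of the product by the double ray of the factor from which
    it comes.  A colour class is then spanning and 2-regular, but it is a disjoint
    union of infinitely many parallel copies of one ray.  These copies are joined
    by switching: if g g' is an edge of the ray i of the first factor and h h' an
    edge of the ray j of the second, then the 4-cycle on {g, g'} x {h, h'} is
    coloured i, j, i, j, and exchanging the two colours on it changes no degree.
    After switching any set of vertex-disjoint 4-cycles, each edge still has one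
    colour and each colour still has degree 2 at each vertex ([row_adj_inj],
    [row_adj_col_adj], [row_edge_coloured], [row_adj_nbrs]), so only the
    connectedness of the colours is at stake.

    There are countably many triples (colour, u, v).  They are served one after
    the other, each by finitely many switches that connect u to v in the given
    colour, inside a finite rectangle P x D that all later squares avoid; hence
    the connection survives in the limit ([limit_family]).  The new squares always
    use columns outside P or rows outside D, which keeps them disjoint.

    The danger is that a finite switching closes a cycle.  For a colour i of the
    first factor, consider the part of the class in the window [-p, p] x D, where
    [-p, p] stands for a segment of the ray i: each row of D leaves the window
    through two ports, one per side, and what is remembered of the class is an
    involution without fixed points matching ports that are connected in the
    window ([wiring]).  Take two rows of D that are consecutive on a ray of the
    second factor, and their ports on one side.  If these ports are not matched
    with each other, then a switch between the two rows just beyond the window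
    connects them, leaves two new ports matched with each other, and matches their
    former partners ([switch_row]).  For the other colour of the square, the same
    switch matches two fresh straight columns ([wirable_switch_fresh]).

    Everything in a rectangle gets connected in two rounds ([connect_rectangle]).
    Let D consist of 2n + 1 consecutive vertices 0, ..., 2n of a ray of the second
    factor.  First switch, on both sides, the rows 2k + 1 and 2k + 2, unless they
    are matched already.  Afterwards they are matched, so the two ports of row 0
    have only each other left as partners.  Then treat the rows 2k and 2k + 1 in
    the same way: whether or not a switch takes place, their previous ports become
    connected.  Together with the matching of the first round this connects the
    ports of the rows 0, 1, ..., 2n on both sides, and every vertex of the window
    is connected to a port. *)

(** * Rays, squares and switched colours *)

Definition ray_edge (r : Z -> nat) (x y : nat) : Prop :=
  exists m, (x = r m /\ y = r (m + 1)) \/ (y = r m /\ x = r (m + 1)).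

Record ray_system (I : Type) (R : I -> Z -> nat) : Prop := RaySystem {
  ray_inj : forall i, injective (R i);
  ray_surj : forall i x, exists m, x = R i m;
  ray_disj : forall i i' x y,
    ray_edge (R i) x y -> ray_edge (R i') x y -> i = i'
}.

(** The vertices of a square are symmetric in [sq_g], [sq_g'] and in [sq_h],
    [sq_h'], so that the direction in which a ray runs through it never matters. *)
Record square (I J : Type) := Square {
  sq_i : I; sq_g : nat; sq_g' : nat;
  sq_j : J; sq_h : nat; sq_h' : nat
}.

Definition in_square (I J : Type) (q : square I J) (x : nat * nat) : Prop :=
  (x.1 = sq_g q \/ x.1 = sq_g' q) /\ (x.2 = sq_h q \/ x.2 = sq_h' q).

(** The colour i of the first factor after switching the squares of [Q]: an edge of
    a row keeps its colour unless it lies in a square, and a square of colour i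
    contributes its two vertical edges.  The colours of the second factor are
    obtained from the same definition by exchanging the coordinates. *)
Definition row_adj (I J : Type) (R : I -> Z -> nat) (Q : square I J -> Prop)
    (i : I) (x y : nat * nat) : Prop :=
  [/\ x.2 = y.2, ray_edge (R i) x.1 y.1
    & forall q, Q q -> in_square q x -> ~ in_square q y] \/
  exists q, [/\ Q q, sq_i q = i, in_square q x, in_square q y
    & x.1 = y.1 /\ x.2 <> y.2].

Definition flip (I J : Type) (q : square I J) : square J I :=
  Square (sq_j q) (sq_h q) (sq_h' q) (sq_i q) (sq_g q) (sq_g' q).

(** Connection by a path that stays in [Y]: such a path is not affected by squares
    that avoid [Y]. *)
Definition conn (I J : Type) (R : I -> Z -> nat) (Q : square I J -> Prop) (i : I)
    (Y : nat * nat -> Prop) : nat * nat -> nat * nat -> Prop :=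
  clos_refl_sym_trans _ (fun x y => [/\ row_adj R Q i x y, Y x & Y y]).

Lemma conn_refl I J R Q i Y x : @conn I J R Q i Y x x.
Proof. exact: rst_refl. Qed.

Lemma conn_sym I J R Q i Y x y : @conn I J R Q i Y x y -> conn R Q i Y y x.
Proof. exact: rst_sym. Qed.

Lemma conn_trans I J R Q i Y y x z :
  @conn I J R Q i Y x y -> conn R Q i Y y z -> conn R Q i Y x z.
Proof. exact: rst_trans. Qed.

Lemma conn_step I J R Q i Y x y :
  @row_adj I J R Q i x y -> Y x -> Y y -> conn R Q i Y x y.
Proof. by move=> *; exact: rst_step. Qed.

Lemma flipK I J (q : square I J) : flip (flip q) = q.
Proof. by case: q. Qed.

Lemma in_square_flip I J (q : square I J) x :
  in_square (flip q) (swap_pair x) <-> in_square q x.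
Proof. by split=> -[]. Qed.

Lemma ray_edge_sym r x y : ray_edge r x y -> ray_edge r y x.
Proof. by move=> [m [[-> ->]|[-> ->]]]; exists m; [right|left]. Qed.

Section Rows.
Variables (I J : Type) (R : I -> Z -> nat).
Hypothesis sysR : ray_system R.
Implicit Types (Q : square I J -> Prop) (i : I) (x y : nat * nat).

Lemma row_adj_sym Q i x y : row_adj R Q i x y -> row_adj R Q i y x.
Proof.
case=> [[e a nq]|[q [Qq qi qx qy [e ne]]]]; [left|right].
  by split; [|exact: ray_edge_sym|move=> q Qq qy qx; exact: nq qx qy].
by exists q; split=> //; split=> // e2; exact: ne.
Qed.

Lemma conn_mono Q Q' i (Y Y' : nat * nat -> Prop) x y :
  (forall a b, Y a -> Y b -> row_adj R Q i a b -> row_adj R Q' i a b) ->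
  (forall a, Y a -> Y' a) ->
  conn R Q i Y x y -> conn R Q' i Y' x y.
Proof.
move=> hQ hY; elim=> [a b [ab Ya Yb]|a|a b _ ba|a b c _ ab _ bc].
- by apply: rst_step; split; [exact: hQ|exact: hY|exact: hY].
- exact: rst_refl.
- exact: rst_sym.
- exact: rst_trans bc.
Qed.

Definition add_square (q : square I J) Q : square I J -> Prop :=
  fun q' => q' = q \/ Q q'.

Lemma row_adj_add_away q Q i x y :
  ~ in_square q x -> row_adj R Q i x y -> row_adj R (add_square q Q) i x y.
Proof.
move=> nqx [[e a nq]|[q' [Qq qi qx qy e]]]; [left|right].
  by split=> // q' [->//|Qq']; exact: nq.
by exists q'; split=> //; right.
Qed.

Lemma ray_edge_neq i (x y : nat) : ray_edge (R i) x y -> x <> y.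
Proof. by move=> [m [[-> ->]|[-> ->]]] /(ray_inj sysR); lia. Qed.

Lemma square_row_edge (q : square I J) x y :
  ray_edge (R (sq_i q)) (sq_g q) (sq_g' q) ->
  in_square q x -> in_square q y -> x.1 <> y.1 ->
  ray_edge (R (sq_i q)) x.1 y.1.
Proof.
by move=> wq [[] -> _] [[] -> _] ne //; apply: ray_edge_sym.
Qed.

(** The horizontal edges of a square have only its own row colour, because the rays
    of a system are edge-disjoint. *)
Lemma row_adj_add_other q Q i x y :
  ray_edge (R (sq_i q)) (sq_g q) (sq_g' q) -> sq_i q <> i ->
  row_adj R Q i x y -> row_adj R (add_square q Q) i x y.
Proof.
move=> wq ni [[e a nq]|[q' [Qq qi qx qy e]]]; last first.
  by right; exists q'; split=> //; right.
left; split=> // q' [->|Qq'] qx qy; last exact: nq qx qy.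
have ne := ray_edge_neq a; apply: ni; apply: (ray_disj sysR) a.
by apply: square_row_edge.
Qed.

(** * Wirings of a window *)

(** A port is a row together with a side; [true] is the positive side of the ray. *)
Definition port (r : Z -> nat) (p : Z) (t : nat * bool) : nat * nat :=
  (r (if t.2 then p else - p), t.1).

Definition window (r : Z -> nat) (p : Z) (D : seq nat) (x : nat * nat) : Prop :=
  x.2 \in D /\ exists2 m, - p <= m <= p & x.1 = r m.

(** What is known of the colour i in the window [-p, p] x D.  By
    [wiring_cover] no component closes up inside the window, and [tau] pairs the
    two ports through which a component leaves it. *)
Record wiring Q (P D : seq nat) i (p : Z) (tau : nat * bool -> nat * bool)
    : Prop := Wiring {
  wiring_ge0 : 0 <= p;
  wiring_cols : forall g, g \in P -> exists2 m, - p <= m <= p & g = R i m;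
  wiring_rows : forall t, t.1 \in D -> (tau t).1 \in D;
  wiring_inv : forall t, t.1 \in D -> tau (tau t) = t;
  wiring_neq : forall t, t.1 \in D -> tau t <> t;
  wiring_conn : forall t, t.1 \in D ->
    conn R Q i (window (R i) p D) (port (R i) p t) (port (R i) p (tau t));
  wiring_cover : forall x, window (R i) p D x ->
    exists2 t, t.1 \in D & conn R Q i (window (R i) p D) x (port (R i) p t)
}.

Definition inside Q (P D : seq nat) : Prop :=
  forall q x, Q q -> in_square q x -> x.1 \in P /\ x.2 \in D.

Lemma conn_segment Q i (Y : nat * nat -> Prop) h m n :
  m <= n ->
  (forall k, m <= k <= n -> Y (R i k, h)) ->
  (forall k, m <= k < n -> row_adj R Q i (R i k, h) (R i (k + 1), h)) ->
  conn R Q i Y (R i m, h) (R i n, h).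
Proof.
move=> le_mn; have [d ->] : exists d : nat, n = m + Z.of_nat d.
  by exists (Z.to_nat (n - m)); lia.
elim: d => [|d IHd] hY adj.
  by rewrite Z.add_0_r; exact: conn_refl.
have -> : m + Z.of_nat d.+1 = m + Z.of_nat d + 1 by lia.
apply: conn_trans (IHd _ _) _.
- by move=> k ?; apply: hY; lia.
- by move=> k ?; apply: adj; lia.
apply: conn_step; [apply: adj|apply: hY|apply: hY]; lia.
Qed.

Lemma ray_edge_succ i m : ray_edge (R i) (R i m) (R i (m + 1)).
Proof. by exists m; left. Qed.

Lemma window_mono r p p' (D D' : seq nat) x : p <= p' -> {subset D <= D'} ->
  window r p D x -> window r p' D' x.
Proof. by move=> le sD [xD [m mp e]]; split; [exact: sD|exists m => //; lia]. Qed.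

Lemma port_window r p (D : seq nat) t : 0 <= p -> t.1 \in D -> window r p D (port r p t).
Proof.
move=> p0 tD; split=> //; exists (if t.2 then p else - p) => //; case: t.2; lia.
Qed.

(** Beyond the columns of [P] there is no square, so each row continues straight
    from a port of the window to the corresponding port of the wider one. *)
Lemma wiring_step Q P P' D i p tau : inside Q P D ->
  wiring Q P D i p tau ->
  (forall g, g \in P' -> exists2 m, - (p+1) <= m <= p+1 & g = R i m) ->
  wiring Q P' D i (p + 1) tau.
Proof.
move=> ins W colP'; have p0 := wiring_ge0 W.
have sub : forall x, window (R i) p D x -> window (R i) (p + 1) D x.
  by move=> x; apply: window_mono => //; lia.
have up x y : conn R Q i (window (R i) p D) x y ->
    conn R Q i (window (R i) (p + 1) D) x y by apply: conn_mono.
have out : forall t : nat * bool, t.1 \in D ->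
    conn R Q i (window (R i) (p + 1) D) (port (R i) p t) (port (R i) (p + 1) t).
  move=> t tD; apply: conn_step; last first.
  - by apply: port_window => //; lia.
  - by apply/sub/port_window.
  left; split=> //=; first by case: t.2; [|exists (- (p + 1)); right; split=> //; f_equal; lia];
    exact: ray_edge_succ.
  move=> q Qq _ /(ins _ _ Qq) [/= /(wiring_cols W)] [m mp] /(ray_inj sysR).
  by case: t.2; lia.
split; first lia.
- exact: colP'.
- exact: wiring_rows W.
- exact: wiring_inv W.
- exact: wiring_neq W.
- move=> t tD; apply: conn_trans (conn_sym (out _ tD)) _.
  apply: conn_trans (out _ (wiring_rows W tD)).
  by apply/up/(wiring_conn W).
- move=> x [xD [m mp e]].
  have [mp'|mE] : (- p <= m <= p) \/ (m = p + 1 \/ m = - (p + 1)) by lia.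
    have [|t tD /up c] := wiring_cover W (x := x); first by split=> //; exists m.
    by exists t => //; apply: conn_trans c _; exact: out.
  case: mE => mE; [exists (x.2, true)|exists (x.2, false)] => //;
    by case: x xD e => x1 x2 /= xD ->; rewrite mE; exact: conn_refl.
Qed.

Lemma wiring_widen Q P P' D i p p' tau : inside Q P D ->
  wiring Q P D i p tau -> p <= p' ->
  (forall g, g \in P' -> exists2 m, - p' <= m <= p' & g = R i m) ->
  wiring Q P' D i p' tau.
Proof.
move=> ins W le_pp' colP'; have [d] : exists d : nat, p' = p + Z.of_nat d.
  by exists (Z.to_nat (p' - p)); lia.
have p0 := wiring_ge0 W.
case: d => [|d] ep.
  have e : p' = p by lia.
  by rewrite e in colP' *; case: W => *; split.
have : wiring Q P D i (p + Z.of_nat d) tau.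
  elim: d {ep} => [|d IHd]; first by rewrite Z.add_0_r.
  have -> : p + Z.of_nat d.+1 = p + Z.of_nat d + 1 by lia.
  apply: wiring_step IHd _ => // g /(wiring_cols W) [m mp ->].
  by exists m => //; lia.
move=> W'; have e : p' = p + Z.of_nat d + 1 by lia.
by rewrite e in colP' *; apply: wiring_step W' _.
Qed.

End Rows.

(** * Rewiring a matching of ports *)

(** The effect of a switch: s and t become matched, and so do their partners. *)
Definition rewire (tau : nat * bool -> nat * bool) (s t u : nat * bool) :=
  if u == s then t else if u == t then s else
  if u == tau s then tau t else if u == tau t then tau s else tau u.

Section Rewire.
Variables (D : seq nat) (tau : nat * bool -> nat * bool).
Hypothesis tauD : forall t, t.1 \in D -> (tau t).1 \in D.
Hypothesis tauK : forall t, t.1 \in D -> tau (tau t) = t.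
Hypothesis tau_neq : forall t, t.1 \in D -> tau t <> t.
Variables s t : nat * bool.
Hypotheses (sD : s.1 \in D) (tD : t.1 \in D) (neq_st : s <> t) (neq_tau : tau s <> t).

Lemma rewireE u : u.1 \in D ->
  [\/ u = s /\ rewire tau s t u = t, u = t /\ rewire tau s t u = s,
      u = tau s /\ rewire tau s t u = tau t |
      [\/ u = tau t /\ rewire tau s t u = tau s |
      [/\ u <> s, u <> t, u <> tau s, u <> tau t & rewire tau s t u = tau u]]].
Proof.
rewrite /rewire => uD.
case: eqP => [|n1]; first by constructor 1.
case: eqP => [|n2]; first by constructor 2.
case: eqP => [|n3]; first by constructor 3.
by constructor 4; case: eqP => [|n4]; [left|right].
Qed.

Lemma rewire_stable u : u.1 \in D -> (rewire tau s t u).1 \in D.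
Proof.
by move=> uD; case: (rewireE uD) => [[_ ->]|[_ ->]|[_ ->]|[[_ ->]|[_ _ _ _ ->]]] //;
  exact: tauD.
Qed.

Lemma rewire_l : rewire tau s t s = t.
Proof. by rewrite /rewire eqxx. Qed.

Lemma rewire_r : rewire tau s t t = s.
Proof. by rewrite /rewire eqxx; case: eqP. Qed.

Lemma rewire_taul : rewire tau s t (tau s) = tau t.
Proof.
have n1 := tau_neq sD; rewrite /rewire; case: eqP => // _; case: eqP => // _.
by rewrite eqxx.
Qed.

Lemma rewire_taur : rewire tau s t (tau t) = tau s.
Proof.
have n1 := tau_neq tD.
have n2 : tau t <> s by move=> e; apply: neq_tau; rewrite -e tauK.
have n3 : tau t <> tau s by move=> e; apply: neq_st; rewrite -(tauK sD) -(tauK tD) e.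
by rewrite /rewire; do 3!case: eqP => // _; rewrite eqxx.
Qed.

Lemma rewire_other u : u.1 \in D -> u <> s -> u <> t -> tau u <> s -> tau u <> t ->
  rewire tau s t u = tau u.
Proof.
move=> uD us ut tus tut; case: (rewireE uD) => [[]|[]|[e]|[[e]|[]]] //.
  by case: tus; rewrite e tauK.
by case: tut; rewrite e tauK.
Qed.

Lemma rewireK u : u.1 \in D -> rewire tau s t (rewire tau s t u) = u.
Proof.
move=> uD; case: (rewireE uD) => [[-> ->]|[-> ->]|[-> ->]|[[-> ->]|[us ut uts utt ->]]].
- exact: rewire_r.
- exact: rewire_l.
- exact: rewire_taur.
- exact: rewire_taul.
have e v : v.1 \in D -> tau u = v -> u = tau v by move=> vD <-; rewrite tauK.
rewrite rewire_other ?tauK //; first exact: tauD.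
- by move/(e _ sD).
- by move/(e _ tD).
Qed.

Lemma rewire_neq u : u.1 \in D -> rewire tau s t u <> u.
Proof.
move=> uD; case: (rewireE uD) => [[-> ->]|[-> ->]|[-> ->]|[[-> ->]|[us ut uts utt ->]]].
- by move/esym.
- exact: neq_st.
- by move=> e; apply: neq_st; rewrite -(tauK sD) -(tauK tD) e.
- by move=> e; apply: neq_st; rewrite -(tauK sD) -(tauK tD) e.
- exact: tau_neq.
Qed.
End Rewire.

(** * Switching a square beyond the window *)

Section Switch.
Variables (I J : Type) (R : I -> Z -> nat).
Hypothesis sysR : ray_system R.
Implicit Types (Q : square I J -> Prop) (i : I).

Definition side (eps : bool) (m : Z) : Z := if eps then m else - m.

Lemma ray_edge_side i eps m : ray_edge (R i) (R i (side eps m)) (R i (side eps (m + 1))).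
Proof.
case: eps => /=; first exact: ray_edge_succ.
apply: ray_edge_sym; have -> : - m = - (m + 1) + 1 by lia.
exact: ray_edge_succ.
Qed.

Lemma side_inj i eps eps' m n : 0 < m -> 0 < n ->
  R i (side eps m) = R i (side eps' n) -> eps = eps' /\ m = n.
Proof. by move=> m0 n0 /(ray_inj sysR); case: eps; case: eps' => /=; lia. Qed.

(** The square occupies the columns at distance p + 1 and p + 2 from the origin of
    the ray.  Its inner vertical edge joins the old ports of h and h', its outer
    vertical edge the new ones.  What could be reached through the old port of h
    can now leave through the partner of that port, which is why the two ports
    must not be partners of each other: otherwise a finite cycle would be closed.
    The last three conclusions record which old connections can be used in the
    wider window. *)
Lemma switch_row Q P D i p tau j (h h' : nat) eps :
  inside Q P D -> wiring R Q P D i p tau ->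
  h \in D -> h' \in D -> h <> h' -> tau (h, eps) <> (h', eps) ->
  let g := R i (side eps (p + 1)) in let g' := R i (side eps (p + 2)) in
  let q := Square i g g' j h h' in
  let Q' := add_square q Q in
  [/\ wiring R Q' [:: g, g' & P] D i (p + 2) (rewire tau (h, eps) (h', eps)),
    (forall t : nat * bool, t.1 \in D -> t <> (h, eps) -> t <> (h', eps) ->
      conn R Q' i (window (R i) (p + 2) D) (port (R i) p t) (port (R i) (p + 2) t)),
    conn R Q' i (window (R i) (p + 2) D) (port (R i) p (h, eps)) (port (R i) p (h', eps))
    & forall x y, conn R Q i (window (R i) p D) x y ->
      conn R Q' i (window (R i) (p + 2) D) x y].
Proof.
move=> ins W hD h'D neh netau g g' q Q'.
set s := (h, eps); set t := (h', eps).
have p0 := wiring_ge0 W.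
set Y := window (R i) (p + 2) D; set C := conn R Q' i Y.
have neq_st : s <> t by case.
have YP (r : nat) e m : r \in D -> 0 <= m <= p + 2 -> Y (R i (side e m), r).
  by move=> rD mp; split=> //; exists (side e m) => //; case: e => /=; lia.
have colP e m : p < m -> R i (side e m) \notin P.
  move=> pm; apply/negP => /(wiring_cols W) [n np] /(ray_inj sysR).
  by case: e => /=; lia.
have up x y : conn R Q i (window (R i) p D) x y -> C x y.
  apply: conn_mono => [a b [_ [m mp ea]] _|a]; last by apply: window_mono => //; lia.
  apply: row_adj_add_away => -[/= [] e _]; move: e; rewrite ea => /(ray_inj sysR);
    by case: (eps) => /=; lia.
(* The step from p to p + 1 avoids the square, the step from p + 1 to p + 2 is
   lost exactly for the two switched ports. *)
have out1 e (r : nat) : r \in D ->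
    C (R i (side e p), r) (R i (side e (p + 1)), r).
  move=> rD; apply: conn_step; [left|apply: YP => //; lia|apply: YP => //; lia].
  split=> //; first exact: ray_edge_side.
  move=> q' [->|Qq']; last by move=> _ /(ins _ _ Qq') [/=]; rewrite (negPf (colP _ _ _)) //; lia.
  by move=> [/= [] /(ray_inj sysR)]; case: (eps); case: (e) => /=; lia.
have out2 e (r : nat) : r \in D -> (r, e) <> s -> (r, e) <> t ->
    C (R i (side e (p + 1)), r) (R i (side e (p + 2)), r).
  move=> rD ns nt; apply: conn_step; [left|apply: YP => //; lia|apply: YP => //; lia].
  have -> : p + 2 = p + 1 + 1 by lia.
  split=> //; first exact: ray_edge_side.
  move=> q' [->|Qq']; last by move=> _ /(ins _ _ Qq') [/=]; rewrite (negPf (colP _ _ _)) //; lia.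
  move=> [/= cx cr]; have ee : e = eps.
    by case: cx => /side_inj [] //; lia.
  by case: cr => er; [case: ns|case: nt]; rewrite ee er.
have cross m : m = p + 1 \/ m = p + 2 -> C (R i (side eps m), h) (R i (side eps m), h').
  move=> mp; apply: conn_step; [right|apply: YP => //; lia|apply: YP => //; lia].
  exists q; split=> //; first by left.
  - by split; [case: mp => ->; [left|right]|left].
  - by split; [case: mp => ->; [left|right]|right].
have portE r m e : port (R i) m (r, e) = (R i (side e m), r) by [].
have out (u : nat * bool) : u.1 \in D -> u <> s -> u <> t ->
    C (port (R i) p u) (port (R i) (p + 2) u).
  case: u => r e /= rD ns nt; rewrite !portE.
  by apply: conn_trans (out1 _ _ rD) (out2 _ _ rD ns nt).
have join : C (port (R i) p s) (port (R i) p t).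
  rewrite !portE; apply: conn_trans (out1 _ _ hD) _.
  by apply: conn_trans (cross _ _) (conn_sym (out1 _ _ h'D)); left.
have join' : C (port (R i) (p + 2) s) (port (R i) (p + 2) t).
  by rewrite !portE; apply: cross; right.
have [tauD tauK tauN] := And3 (wiring_rows W) (wiring_inv W) (wiring_neq W).
have netau' : tau t <> s by move=> e; apply: netau; rewrite -/s -e tauK.
have link u : u.1 \in D -> C (port (R i) p u) (port (R i) p (tau u)).
  by move=> uD; apply/up/(wiring_conn W).
(* The component of an old switched port leaves through its partner. *)
have outs : C (port (R i) p s) (port (R i) (p + 2) (tau s)).
  by apply: (conn_trans (link s hD)); apply: out => //; [exact: tauD|exact: tauN].
have outt : C (port (R i) p t) (port (R i) (p + 2) (tau t)).
  by apply: (conn_trans (link t h'D)); apply: out => //; [exact: tauD|exact: tauN].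
have tautau : C (port (R i) (p + 2) (tau s)) (port (R i) (p + 2) (tau t)).
  apply: conn_trans (conn_sym outs) _; exact: conn_trans join outt.
have escape u : u.1 \in D -> exists2 v, v.1 \in D & C (port (R i) p u) (port (R i) (p + 2) v).
  move=> uD; have [->|/eqP us] := eqVneq u s; first by exists (tau s) => //; exact: tauD.
  have [->|/eqP ut] := eqVneq u t; first by exists (tau t) => //; exact: tauD.
  by exists u => //; exact: out.
split=> //; split; first lia.
- move=> x; rewrite !inE => /or3P [/eqP ->|/eqP ->|/(wiring_cols W) [m mp ->]].
  + by exists (side eps (p + 1)) => //; case: (eps) => /=; lia.
  + by exists (side eps (p + 2)) => //; case: (eps) => /=; lia.
  + by exists m => //; lia.
- exact: rewire_stable.
- exact: rewireK.
- exact: rewire_neq.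
- move=> u uD.
  case: (rewireE tau s t uD) => [[-> ->]|[-> ->]|[-> ->]|[[-> ->]|[us ut uts utt ->]]] //.
  + exact: conn_sym.
  + exact: conn_sym.
  + have e v : v.1 \in D -> tau u = v -> u = tau v by move=> vD <-; rewrite tauK.
    apply: conn_trans (conn_sym (out _ uD us ut)) _.
    apply: (conn_trans (link _ uD)); apply: out; first exact: tauD.
      by move/(e s hD).
    by move/(e t h'D).
- move=> [x r] [/= rD [m mp ->]].
  have [mp'|] : (- p <= m <= p) \/ (p < Z.abs m <= p + 2) by lia.
    have [|u uD /up c] := wiring_cover W (x := (R i m, r)); first by split=> //; exists m.
    by have [v vD c'] := escape _ uD; exists v => //; exact: conn_trans c c'.
  have [e [n [-> n0]]] : exists e n, m = side e n /\ 0 <= n.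
    by exists (0 <=? m), (Z.abs m); case: (Z.leb_spec 0 m) => /=; lia.
  move=> np; have {np mp} [->|->] : n = p + 1 \/ n = p + 2 by case: (e) np => /=; lia.
    have [v vD c] := escape (r, e) rD; exists v => //.
    by apply: conn_trans (conn_sym (out1 _ _ rD)) c.
  by exists (r, e) => //; exact: conn_refl.
Qed.

End Switch.

(** * Fresh rows and other colours *)

Section Fresh.
Variables (I J : Type) (R : I -> Z -> nat).
Hypothesis sysR : ray_system R.
Implicit Types (Q : square I J -> Prop) (P D : seq nat) (i : I).

Definition wirable Q P D i : Prop := exists p tau, wiring R Q P D i p tau.

Lemma cols_bound i P : exists2 p, 0 <= p &
  forall g, g \in P -> exists2 m, - p <= m <= p & g = R i m.
Proof.
elim: P => [|g P [p p0 IHp]]; first by exists 0.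
have [m ->] := ray_surj sysR i g; exists (Z.max p (Z.abs m)); first lia.
move=> x; rewrite inE => /orP [/eqP ->|/IHp [n np ->]]; first by exists m => //; lia.
by exists n => //; lia.
Qed.

Lemma wirable_add_cols Q P P' D i : inside Q P D ->
  wirable Q P D i -> wirable Q P' D i.
Proof.
move=> ins [p [tau W]]; have [p' p'0 colP'] := cols_bound i P'.
exists (Z.max p p'), tau; apply: (wiring_widen _ ins W); [by []|lia|].
by move=> g /colP' [m mp ->]; exists m => //; lia.
Qed.

Lemma wiring_add_squareuares Q Q' P D i p tau :
  (forall x y, row_adj R Q i x y -> row_adj R Q' i x y) ->
  wiring R Q P D i p tau -> wiring R Q' P D i p tau.
Proof.
move=> hQ [p0 cP tD tK tN link cover].
have up x y : conn R Q i (window (R i) p D) x y -> conn R Q' i (window (R i) p D) x y.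
  by apply: conn_mono => // *; exact: hQ.
split=> // [t /link /up //|x /cover [t tD' /up c]]; by exists t.
Qed.

Lemma wirable_add_other q Q P D i :
  ray_edge (R (sq_i q)) (sq_g q) (sq_g' q) -> sq_i q <> i ->
  wirable Q P D i -> wirable (add_square q Q) P D i.
Proof.
move=> wq ni [p [tau W]]; exists p, tau; apply: wiring_add_squareuares W => x y.
exact: row_adj_add_other.
Qed.

Lemma conn_fresh_row Q i p D r m n : r \in D -> - p <= m -> m <= n -> n <= p ->
  (forall q k, Q q -> m <= k < n -> in_square q (R i k, r) ->
     ~ in_square q (R i (k + 1), r)) ->
  conn R Q i (window (R i) p D) (R i m, r) (R i n, r).
Proof.
move=> rD pm mn np nq; apply: conn_segment => // k kmn.
  by split=> //; exists k => //; lia.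
left; split=> //; first exact: ray_edge_succ.
by move=> q Qq; exact: nq Qq kmn.
Qed.

(** New rows contain no square, hence run straight from one port to the other. *)
Lemma wirable_add_rows Q P D D' i : inside Q P D -> {subset D <= D'} ->
  wirable Q P D i -> wirable Q P D' i.
Proof.
move=> ins sD [p [tau [p0 cP tD tK tN link cover]]].
exists p, (fun t => if t.1 \in D then tau t else (t.1, ~~ t.2)).
have up x y : conn R Q i (window (R i) p D) x y -> conn R Q i (window (R i) p D') x y.
  by apply: conn_mono => // a; apply: window_mono => //; lia.
have seg m n r : r \in D' -> r \notin D -> - p <= m -> m <= n -> n <= p ->
    conn R Q i (window (R i) p D') (R i m, r) (R i n, r).
  move=> rD' rD ? ? ?; apply: conn_fresh_row => // q k Qq _ /(ins _ _ Qq) [_ /=].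
  by rewrite (negPf rD).
split=> //.
- by move=> t tD'; case: ifP => //= /tD; exact: sD.
- move=> t tD'; case: (boolP (t.1 \in D)) => [tD1|tD1] /=; first by rewrite tD // tK.
  by rewrite (negPf tD1) negbK; case: (t).
- move=> t tD'; case: ifP => [/tN //|_]; case: (t) => a b []; by case: b.
- move=> [r e] rD'; case: ifP => [/link /up //|/negbT /= rD].
  by case: e rD' rD => /= rD' rD; [apply: conn_sym|]; apply: seg => //; lia.
- move=> [x r] [/= rD' [m mp ->]]; have [rD|rD] := boolP (r \in D).
    have [|t tD1 /up c] := cover (R i m, r); first by split=> //; exists m.
    by exists t => //; exact: sD.
  by exists (r, true) => //; apply: seg => //; lia.
Qed.

(** The colour i loses the edge between the positions m and m + 1 in two straight
    rows and gains the two vertical edges there, which matches the ports of the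
    two rows side by side. *)
Lemma wirable_switch_fresh q Q P D i m : inside Q P D -> wirable Q P D i ->
  sq_i q = i -> sq_g q = R i m -> sq_g' q = R i (m + 1) ->
  sq_g q \in P -> sq_g' q \in P ->
  sq_h q \notin D -> sq_h' q \notin D -> sq_h q <> sq_h' q ->
  wirable (add_square q Q) P [:: sq_h q, sq_h' q & D] i.
Proof.
case: q => i' g g' j h h' /= ins [p [tau [p0 cP tD tK tN link cover]]] ei eg eg' gP g'P hD h'D neh.
subst i' g g'; set q := Square _ _ _ _ _ _.
have [[n np /(ray_inj sysR) en] [n' n'p /(ray_inj sysR) en']] := conj (cP _ gP) (cP _ g'P).
subst n n'; set D' := [:: h, h' & D]; set Y := window (R i) p D'.
set C := conn R (add_square q Q) i Y.
have sD : {subset D <= D'} by move=> r rD; rewrite !inE rD !orbT.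
have hD' : h \in D' by rewrite !inE eqxx.
have h'D' : h' \in D' by rewrite !inE eqxx orbT.
have up x y : conn R Q i (window (R i) p D) x y -> C x y.
  apply: conn_mono => [a b [aD _] _|a]; last by apply: window_mono => //; lia.
  by apply: row_adj_add_away => -[_ /= [] e]; move: aD; rewrite e ?(negPf hD) ?(negPf h'D).
have seg a b r : r = h \/ r = h' -> - p <= a -> a <= b -> b <= p -> (b <= m \/ m < a) ->
    C (R i a, r) (R i b, r).
  move=> rh pa ab bp abm; apply: conn_fresh_row => //; first by case: rh => ->.
  move=> q' k [->|Qq'] kab; last first.
    by move=> /(ins _ _ Qq') [_ /=]; case: rh => ->; rewrite ?(negPf hD) ?(negPf h'D).
  by move=> [/= c1 _] [/= c2 _]; case: c1 c2 => /(ray_inj sysR) e1 [] /(ray_inj sysR) e2; lia.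
have cross a : a = m \/ a = m + 1 -> C (R i a, h) (R i a, h').
  move=> am; apply: conn_step; last 2 first.
  - by split=> //; exists a => //; lia.
  - by split=> //; exists a => //; lia.
  right; exists q; split=> //; first by left.
  - by split; [case: am => ->; [left|right]|left].
  - by split; [case: am => ->; [left|right]|right].
have join e : C (port (R i) p (h, e)) (port (R i) p (h', e)).
  case: e; rewrite /port /=.
    apply: (@conn_trans _ _ _ _ _ _ (R i (m + 1), h)).
      by apply: conn_sym; apply: seg; [left|lia..].
    apply: (@conn_trans _ _ _ _ _ _ (R i (m + 1), h')); first by apply: cross; right.
    by apply: seg; [right|lia..].
  apply: (@conn_trans _ _ _ _ _ _ (R i m, h)); first by apply: seg; [left|lia..].
  apply: (@conn_trans _ _ _ _ _ _ (R i m, h')); first by apply: cross; left.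
  by apply: conn_sym; apply: seg; [right|lia..].
pose tau' (t : nat * bool) :=
  if t.1 == h then (h', t.2) else if t.1 == h' then (h, t.2) else tau t.
have tau'E t : t.1 \in D' -> [\/ t = (h, t.2) /\ tau' t = (h', t.2),
    t = (h', t.2) /\ tau' t = (h, t.2) | t.1 \in D /\ tau' t = tau t].
  case: t => r e /=; rewrite /tau' !inE /=.
  case: eqP => [->|_]; first by constructor 1.
  by case: eqP => [->|_] //; [constructor 2|constructor 3].
have tau'h e : tau' (h, e) = (h', e) by rewrite /tau' /= eqxx.
have tau'h' e : tau' (h', e) = (h, e).
  by rewrite /tau' /= eqxx; case: eqP => // e'; case: neh.
have tau'D t : t.1 \in D -> tau' t = tau t.
  move=> tD1; rewrite /tau'; case: eqP tD1 => [->|_]; first by rewrite (negPf hD).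
  by case: eqP => // ->; rewrite (negPf h'D).
exists p, tau'; split=> //.
- by move=> t /tau'E [[_ ->]|[_ ->]|[tD1 ->]] //; exact/sD/tD.
- move=> t /tau'E [[-> ->]|[-> ->]|[tD1 ->]] //; rewrite tau'D ?tK //; exact: tD.
- move=> t /tau'E [[-> ->]|[-> ->]|[tD1 ->]] //; last exact: tN.
    by case=> /esym.
  by case.
- move=> t /tau'E [[-> ->]|[-> ->]|[tD1 ->]]; last exact/up/link.
    exact: join.
  by apply: conn_sym; exact: join.
- move=> [x r] [/= rD' [k kp ->]].
  have [rh|rD] : (r = h \/ r = h') \/ r \in D.
    by move: rD'; rewrite !inE => /or3P [/eqP|/eqP|]; auto.
  + have [km|km] := Z_le_gt_dec k m.
      by exists (r, false) => //; apply: conn_sym; apply: seg => //; lia.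
    by exists (r, true) => //; apply: seg => //; lia.
  + have [|t tD1 /up c] := cover (R i k, r); first by split=> //; exists k.
    by exists t => //; exact: sD.
Qed.
End Fresh.

(** * Admissible states *)

Section Admissible.

Definition transpose (I J : Type) (Q : square I J -> Prop) : square J I -> Prop :=
  fun q => Q (flip q).

Lemma transposeK I J (Q : square I J -> Prop) : transpose (transpose Q) = Q.
Proof. by apply/funext => q; rewrite /transpose flipK. Qed.

Lemma transpose_add I J (q : square I J) Q :
  transpose (add_square q Q) = add_square (flip q) (transpose Q).
Proof.
apply/funext => q'; apply/propext; split=> -[e|Qq]; try by right.
  by left; rewrite -e flipK.
by left; rewrite e flipK.
Qed.

(** Disjointness is asked for vertices, not only for edges: a vertex then lies in
    at most one square, and its neighbours in each colour are easy to list. *)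
Record square_family (I J : Type) (R : I -> Z -> nat) (S : J -> Z -> nat)
    (Q : square I J -> Prop) : Prop := SquareFamily {
  family_row : forall q, Q q -> ray_edge (R (sq_i q)) (sq_g q) (sq_g' q);
  family_col : forall q, Q q -> ray_edge (S (sq_j q)) (sq_h q) (sq_h' q);
  family_disjoint : forall q q' x,
    Q q -> Q q' -> in_square q x -> in_square q' x -> q = q'
}.

Lemma square_family_transpose I J R S (Q : square I J -> Prop) :
  square_family R S Q -> square_family S R (transpose Q).
Proof.
case=> ge he disj; split=> [q /he|q /ge|q q' x Qq Qq'] //.
move=> /in_square_flip qx /in_square_flip q'x.
by rewrite -(flipK q) -(flipK q'); congr flip; apply: disj qx q'x.
Qed.

(** The condition on the columns is the condition on the rows with the coordinates
    exchanged, so every statement about the colours of one factor transfers to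
    those of the other by [admissible_transpose]. *)
Record admissible (I J : Type) (R : I -> Z -> nat) (S : J -> Z -> nat)
    (Q : square I J -> Prop) (P D : seq nat) : Prop := Admissible {
  admissible_family : square_family R S Q;
  admissible_inside : inside Q P D;
  admissible_rows : forall i, wirable R Q P D i;
  admissible_cols : forall j, wirable S (transpose Q) D P j
}.

Lemma inside_transpose I J (Q : square I J -> Prop) P D :
  inside Q P D -> inside (transpose Q) D P.
Proof.
move=> ins q x Qq qx; have [] := ins _ (swap_pair x) Qq => //.
by apply/in_square_flip; case: x qx.
Qed.

Lemma admissible_transpose I J R S (Q : square I J -> Prop) P D :
  admissible R S Q P D -> admissible S R (transpose Q) D P.
Proof.
case=> fam ins rows cols; split.
- exact: square_family_transpose.
- exact: inside_transpose.
- exact: cols.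
- by move=> i; rewrite transposeK.
Qed.

(** The last clause says that the rectangle P x D is frozen: squares added later
    do not meet it. *)
Definition extends I J (Q : square I J -> Prop) (P D : seq nat)
    (Q' : square I J -> Prop) (P' D' : seq nat) : Prop :=
  [/\ {subset P <= P'}, {subset D <= D'}, forall q, Q q -> Q' q
    & forall q x, Q' q -> in_square q x -> x.1 \in P -> x.2 \in D -> Q q].

Lemma extends_refl I J (Q : square I J -> Prop) P D : extends Q P D Q P D.
Proof. by split. Qed.

Lemma extends_trans I J (Q Q' Q'' : square I J -> Prop) P P' P'' D D' D'' :
  extends Q P D Q' P' D' -> extends Q' P' D' Q'' P'' D'' -> extends Q P D Q'' P'' D''.
Proof.
move=> [sP sD sQ new] [sP' sD' sQ' new']; split.
- by move=> x /sP/sP'.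
- by move=> x /sD/sD'.
- by move=> q /sQ/sQ'.
- move=> q x Q''q qx xP xD; apply: (new) (qx) (xP) (xD).
  by apply: new' Q''q qx _ _; [exact: sP|exact: sD].
Qed.

Lemma extends_transpose I J (Q Q' : square I J -> Prop) P P' D D' :
  extends (transpose Q) D P (transpose Q') D' P' -> extends Q P D Q' P' D'.
Proof.
move=> [sD sP sQ new]; split=> //.
- by move=> q Qq; have := sQ (flip q); rewrite /transpose flipK; exact.
- move=> q x Q'q qx xP xD.
  have := new (flip q) (swap_pair x); rewrite /transpose flipK; apply=> //.
  by apply/in_square_flip.
Qed.

Variables (I J : Type) (R : I -> Z -> nat) (S : J -> Z -> nat).
Hypotheses (sysR : ray_system R) (sysS : ray_system S).
Implicit Types (Q : square I J -> Prop) (P D : seq nat) (i : I) (j : J).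

Lemma extends_enlarge Q P D P' D' : {subset P <= P'} -> {subset D <= D'} ->
  extends Q P D Q P' D'.
Proof. by []. Qed.

Lemma admissible_enlarge Q P D P' D' : {subset P <= P'} -> {subset D <= D'} ->
  admissible R S Q P D -> admissible R S Q P' D'.
Proof.
move=> sP sD [fam ins rows cols].
have ins1 : inside Q P' D by move=> q x Qq /(ins _ _ Qq) [/sP].
split=> //.
- by move=> q x Qq /(ins1 _ _ Qq) [? /sD].
- by move=> i; apply: (wirable_add_rows ins1) => //; exact: wirable_add_cols (rows i).
- move=> j; apply: (wirable_add_cols sysS (P := D)); first exact: inside_transpose.
  exact: (wirable_add_rows (inside_transpose ins)).
Qed.

(** A switch concerns three kinds of colours: i is rewired by [switch_row], j
    receives two fresh columns, which get matched by [wirable_switch_fresh], and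
    all others are unaffected. *)
Lemma admissible_switch Q P D i p tau j m eps :
  admissible R S Q P D -> wiring R Q P D i p tau ->
  S j m \in D -> S j (m + 1) \in D -> tau (S j m, eps) <> (S j (m + 1), eps) ->
  let g := R i (side eps (p + 1)) in let g' := R i (side eps (p + 2)) in
  let q := Square i g g' j (S j m) (S j (m + 1)) in
  admissible R S (add_square q Q) [:: g, g' & P] D /\
  extends Q P D (add_square q Q) [:: g, g' & P] D.
Proof.
move=> G W hD h'D netau g g' q.
have neh : S j m <> S j (m + 1) by move=> /(ray_inj sysS); lia.
have p0 := wiring_ge0 W; have [fam ins rows cols] := G.
have colP e k : p < k -> R i (side e k) \notin P.
  move=> pk; apply/negP => /(wiring_cols W) [n np] /(ray_inj sysR).
  by case: e => /=; lia.
have gP : g \notin P by apply: colP; lia.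
have g'P : g' \notin P by apply: colP; lia.
have neg : g <> g' by move=> /(side_inj sysR) []; lia.
have wq : ray_edge (R i) g g'.
  by rewrite /g' (_ : p + 2 = p + 1 + 1); [exact: ray_edge_side|lia].
have nqP q' x : Q q' -> in_square q x -> ~ in_square q' x.
  by move=> Qq' [/= c _] /(ins _ _ Qq') [xP _]; case: c xP => ->; rewrite ?(negPf gP) ?(negPf g'P).
have sP : {subset P <= [:: g, g' & P]} by move=> x xP; rewrite !inE xP !orbT.
split; last first.
  split=> //; first by right.
  by move=> q' x [->|//] [/= c _] xP; case: c xP => ->; rewrite ?(negPf gP) ?(negPf g'P).
split.
- have [ge he disj] := fam; split.
  + by move=> q' [->|/ge].
  + by move=> q' [->|/he] //; exact: ray_edge_succ.
  + move=> q1 q2 x [->|Q1] [->|Q2] // x1 x2.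
    * by case: (nqP _ _ Q2 x1).
    * by case: (nqP _ _ Q1 x2).
    * exact: disj x1 x2.
- move=> q' x [->|Qq'] qx; last by have [/sP] := ins _ _ Qq' qx.
  by case: qx => /= -[] -> [] ->; rewrite !inE ?eqxx ?orbT.
- move=> i'; have [<-|ne] := pselect (i = i').
    exists (p + 2), (rewire tau (S j m, eps) (S j (m + 1), eps)).
    by have [] := switch_row sysR j ins W hD h'D neh netau.
  by apply: wirable_add_other => //; exact: wirable_add_cols (rows i').
- move=> j'; rewrite transpose_add; have [<-|ne] := pselect (j = j').
    by apply: (wirable_switch_fresh sysS (m := m) (inside_transpose ins)) => //=; exact: cols.
  apply: (wirable_add_other sysS) => //=; first exact: ray_edge_succ.
  exact: (wirable_add_rows (inside_transpose ins)).
Qed.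
End Admissible.

(** * Connecting a rectangle in one colour *)

Definition rectangle (P D : seq nat) (x : nat * nat) : Prop :=
  x.1 \in P /\ x.2 \in D.

Section Work.
Variables (I J : Type) (R : I -> Z -> nat) (S : J -> Z -> nat).
Hypotheses (sysR : ray_system R) (sysS : ray_system S).
Variables (D : seq nat) (i : I) (j : J).
Implicit Types (Q : square I J -> Prop) (P : seq nat).

Definition continues Q P p Q' P' p' tau' : Prop :=
  [/\ admissible R S Q' P' D, extends Q P D Q' P' D, wiring R Q' P' D i p' tau'
    & forall x y, conn R Q i (window (R i) p D) x y ->
        conn R Q' i (window (R i) p' D) x y].

(** If the two ports are matched already they are connected and nothing is to be
    done, otherwise they are switched; either way they end up connected, and the
    ports of the same rows and side in the new window end up matched. *)
Lemma join_ports Q P p tau m e :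
  admissible R S Q P D -> wiring R Q P D i p tau ->
  S j m \in D -> S j (m + 1) \in D ->
  let s := (S j m, e) in let t := (S j (m + 1), e) in
  exists Q' P' p' tau', continues Q P p Q' P' p' tau' /\
    let C := conn R Q' i (window (R i) p' D) in
    [/\ tau' s = t, C (port (R i) p s) (port (R i) p t),
      forall u : nat * bool, u.1 \in D -> u <> s -> u <> t ->
        C (port (R i) p u) (port (R i) p' u)
    & forall u : nat * bool, u.1 \in D -> u <> s -> u <> t ->
        tau u <> s -> tau u <> t -> tau' u = tau u].
Proof.
move=> G W sD tD s t.
have [e1|ne] := eqVneq (tau s) t.
  exists Q, P, p, tau; split; first by split=> //; exact: extends_refl.
  split=> //; last by move=> *; exact: conn_refl.
  by rewrite -e1; exact: (wiring_conn W (t := s)).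
have neh : S j m <> S j (m + 1) by move=> /(ray_inj sysS); lia.
have nst : s <> t by case.
have [W' out join up] := switch_row sysR j (admissible_inside G) W sD tD neh (elimN eqP ne).
have [G' X'] := admissible_switch sysR sysS G W sD tD (elimN eqP ne).
do 4!eexists; split; first by split; [exact: G'|exact: X'|exact: W'|].
split=> //; first exact: rewire_l.
by move=> u uD *; apply: rewire_other => //; first exact: (wiring_inv W).
Qed.

(** The pairs in [L] use different ports, so they can be treated one by one: each
    pair still has its original ports, up to straight prolongation, when its turn
    comes, and the matching of the earlier pairs is not disturbed. *)
Lemma join_all_ports Q P p tau b (L : seq (nat * bool)) :
  let lo k := S j (b + Z.of_nat k.*2) in
  let hi k := S j (b + Z.of_nat k.*2 + 1) in
  let untouched (t : nat * bool) :=
    forall k e, (k, e) \in L -> t <> (lo k, e) /\ t <> (hi k, e) in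
  admissible R S Q P D -> wiring R Q P D i p tau -> uniq L ->
  (forall k e, (k, e) \in L -> lo k \in D /\ hi k \in D) ->
  exists Q' P' p' tau', continues Q P p Q' P' p' tau' /\
    let C := conn R Q' i (window (R i) p' D) in
    [/\ forall k e, (k, e) \in L -> tau' (lo k, e) = (hi k, e),
      forall k e, (k, e) \in L ->
        C (port (R i) p (lo k, e)) (port (R i) p (hi k, e)),
      forall t : nat * bool, t.1 \in D -> untouched t ->
        C (port (R i) p t) (port (R i) p' t)
    & forall t : nat * bool, t.1 \in D -> untouched t -> untouched (tau t) ->
        tau' t = tau t].
Proof.
move=> lo hi; elim: L Q P p tau => [|[k e] L IHL] Q P p tau /= G W.
  move=> _ _; exists Q, P, p, tau; split; first by split=> //; exact: extends_refl.
  by split=> // *; exact: conn_refl.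
move=> /andP [nL uL] LD.
have [sD tD] : lo k \in D /\ hi k \in D by apply: (LD k e); rewrite inE eqxx.
have [Q1 [P1 [p1 [tau1 [[G1 X1 W1 up1] /= [tau1s join1 out1 tau1u]]]]]] :=
  join_ports e G W sD tD.
have [|Q2 [P2 [p2 [tau2 [[G2 X2 W2 up2] /= [tau2L join2 out2 tau2u]]]]]] :=
  IHL _ _ _ _ G1 W1 uL.
  by move=> k' e' kL; apply: (LD k' e'); rewrite inE kL orbT.
have loI k1 k2 : lo k1 = lo k2 -> k1 = k2 by move/(ray_inj sysS); lia.
have hiI k1 k2 : hi k1 = hi k2 -> k1 = k2 by move/(ray_inj sysS); lia.
have lohi k1 k2 : lo k1 <> hi k2 by move/(ray_inj sysS); lia.
have sepL k' e' : (k', e') \in L ->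
  [/\ (lo k, e) <> (lo k', e'), (hi k, e) <> (hi k', e'),
      (lo k, e) <> (hi k', e') & (hi k, e) <> (lo k', e')].
  move=> kL; have ne : (k, e) <> (k', e') by move=> E; rewrite E kL in nL.
  split=> -[].
  - by move=> /loI E1 E2; apply: ne; rewrite E1 E2.
  - by move=> /hiI E1 E2; apply: ne; rewrite E1 E2.
  - by move/lohi.
  - by move/esym/lohi.
exists Q2, P2, p2, tau2; split.
  split=> //; first exact: extends_trans X1 X2.
  by move=> x y /up1/up2.
split.
- move=> k' e'; rewrite inE => /orP [/eqP [-> ->]|kL]; last exact: tau2L.
  rewrite tau2u ?tau1s // => k2 e2 /sepL [n1 n2 n3 n4]; by split.
- move=> k' e'; rewrite inE => /orP [/eqP [-> ->]|kL]; first exact/up2/join1.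
  have [lD hD] : lo k' \in D /\ hi k' \in D by apply: (LD k' e'); rewrite inE kL orbT.
  have [n1 n2 n3 n4] := sepL _ _ kL.
  apply: (@conn_trans _ _ _ _ _ _ (port (R i) p1 (lo k', e'))).
    by apply/up2/out1 => //; exact: nesym.
  apply: (conn_trans (join2 _ _ kL)); apply: conn_sym.
  by apply/up2/out1 => //; exact: nesym.
- move=> t tD1 tU; apply: (@conn_trans _ _ _ _ _ _ (port (R i) p1 t)).
    by have [ts tt] := tU k e (mem_head _ _); apply/up2/out1.
  by apply: out2 => // k' e' kL; apply: tU; rewrite inE kL orbT.
- move=> t tD1 tU tauU.
  have [ts tt] := tU k e (mem_head _ _).
  have [us ut] := tauU k e (mem_head _ _).
  have e1 : tau1 t = tau t by exact: tau1u.
  rewrite -e1; apply: tau2u => // k' e' kL; last rewrite e1.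
    by apply: tU; rewrite inE kL orbT.
  by apply: tauU; rewrite inE kL orbT.
Qed.

(** The two rounds of the overview, with offsets [a + 1] and [a]. *)
Lemma connect_rectangle Q P a n : admissible R S Q P D ->
  (forall k, (k <= n.*2)%N -> S j (a + Z.of_nat k) \in D) ->
  (forall r, r \in D -> exists2 k, (k <= n.*2)%N & r = S j (a + Z.of_nat k)) ->
  exists Q' P', [/\ admissible R S Q' P' D, extends Q P D Q' P' D
    & forall x y, rectangle P D x -> rectangle P D y -> conn R Q' i (rectangle P' D) x y].
Proof.
move=> G SD DS.
pose L := [seq (k, e) | k <- iota 0 n, e <- [:: true; false]].
have uL : uniq L.
  by apply: allpairs_uniq => //; [exact: iota_uniq|move=> [? ?] [? ?]].
have inL k e : ((k, e) \in L) = (k < n)%N.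
  apply/allpairsP/idP => [[[k' e'] [/= + _ [-> _]]]|kn]; first by rewrite mem_iota.
  by exists (k, e); rewrite mem_iota /= kn; case: e.
have [p [tau W]] := admissible_rows G i.
have [|Q1 [P1 [p1 [tau1 [[G1 X1 W1 up1] /= [tau1L _ _ _]]]]]] :=
    join_all_ports (b := a + 1) G W uL.
  move=> k e; rewrite inL => kn; split.
    rewrite (_ : _ + _ = a + Z.of_nat k.*2.+1); last by lia.
    by apply: SD; lia.
  rewrite (_ : _ + 1 = a + Z.of_nat k.*2.+2); last by lia.
  by apply: SD; lia.
have {}tau1L k e : (k < n)%N ->
    tau1 (S j (a + Z.of_nat k.*2.+1), e) = (S j (a + Z.of_nat k.*2.+2), e).
  move=> kn; have := tau1L k e; rewrite inL kn => /(_ isT).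
  rewrite (_ : a + 1 + _ = a + Z.of_nat k.*2.+1); last by lia.
  by rewrite (_ : a + Z.of_nat k.*2.+1 + 1 = a + Z.of_nat k.*2.+2); last by lia.
have aD : S j (a + Z.of_nat 0) \in D by exact: SD.
(* All ports other than those of row 0 are matched among themselves. *)
have tau0 : tau1 (S j (a + Z.of_nat 0), true) = (S j (a + Z.of_nat 0), false).
  set s := (S j _, true); have sD : s.1 \in D by [].
  have := wiring_rows W1 sD; have := wiring_inv W1 sD; have := wiring_neq W1 sD.
  case: (tau1 s) => r e /= nes tau1re /DS [k kn er]; rewrite {r}er in nes tau1re *.
  case: k kn nes tau1re => [|k] kn nes tau1re; first by case: e nes {tau1re}.
  have [l ek] : exists l, k = l.*2 \/ k = l.*2.+1.
    by exists k./2; have := odd_double_half k; case: odd => /=; lia.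
  case: ek => ek; rewrite {k}ek in kn nes tau1re *.
    by move: tau1re; rewrite tau1L; [move=> [/(ray_inj sysS) E _]; lia|lia].
  have lD : S j (a + Z.of_nat l.*2.+1) \in D by apply: SD; lia.
  have := wiring_inv W1 (t := (S j (a + Z.of_nat l.*2.+1), e)) lD.
  rewrite tau1L; last by lia.
  by rewrite tau1re => -[/(ray_inj sysS) E _]; lia.
have [|Q2 [P2 [p2 [tau2 [[G2 X2 W2 up2] /= [_ join2 _ _]]]]]] :=
    join_all_ports (b := a) G1 W1 uL.
  move=> k e; rewrite inL => kn; split.
    by apply: SD; lia.
  rewrite (_ : _ + 1 = a + Z.of_nat k.*2.+1); last by lia.
  by apply: SD; lia.
set C := conn R Q2 i (window (R i) p2 D) in join2 up2.
have {}join2 k e : (k < n)%N ->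
    C (port (R i) p1 (S j (a + Z.of_nat k.*2), e))
      (port (R i) p1 (S j (a + Z.of_nat k.*2.+1), e)).
  move=> kn; have := join2 k e; rewrite inL kn => /(_ isT).
  by rewrite (_ : a + Z.of_nat k.*2 + 1 = a + Z.of_nat k.*2.+1); last by lia.
have all_ports k e : (k <= n.*2)%N ->
    C (port (R i) p1 (S j (a + Z.of_nat k), e))
      (port (R i) p1 (S j (a + Z.of_nat 0), true)).
  elim: k => [|k IHk] kn.
    case: e; first exact: conn_refl.
    apply: conn_sym; rewrite -tau0; apply: up2.
    exact: (wiring_conn W1 (t := (_, true))).
  apply: conn_trans (IHk (ltnW kn)); apply: conn_sym.
  have [l ek] : exists l, k = l.*2 \/ k = l.*2.+1.
    by exists k./2; have := odd_double_half k; case: odd => /=; lia.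
  case: ek => ek; rewrite {k IHk}ek in kn *; first by apply: join2; lia.
  rewrite -tau1L; last by lia.
  by apply/up2/(wiring_conn W1 (t := (_, e))); apply: SD; lia.
have all x : rectangle P D x -> C x (port (R i) p1 (S j (a + Z.of_nat 0), true)).
  move=> [xP xD].
  have [|[r e] /= /DS [k kn ->] c] := wiring_cover W1 (x := x).
    by split=> //; apply: (wiring_cols W1); have [sP _ _ _] := X1; exact: sP.
  by apply: conn_trans (up2 _ _ c) (all_ports _ _ kn).
(* The columns of the window are added in order to freeze it. *)
pose P3 := P2 ++ [seq R i (Z.of_nat k - p2) | k <- iota 0 (Z.to_nat (2 * p2 + 1))].
have sP : {subset P2 <= P3} by move=> x xP; rewrite mem_cat xP.
exists Q2, P3; split.
- exact: (admissible_enlarge sysR sysS sP (fun x (xD : x \in D) => xD) G2).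
- by apply: extends_trans X1 (extends_trans X2 _); exact: extends_enlarge sP _.
move=> x y /all cx /all cy; have := conn_trans cx (conn_sym cy).
apply: conn_mono => // z [zD [m mp ez]]; split=> //.
rewrite mem_cat ez; apply/orP; right; apply/mapP.
exists (Z.to_nat (m + p2)); last by congr (R i _); lia.
by rewrite mem_iota; lia.
Qed.
End Work.

Lemma connect_points I J (R : I -> Z -> nat) (S : J -> Z -> nat) (j : J)
    Q P D i u v : ray_system R -> ray_system S -> admissible R S Q P D ->
  exists Q' P' D', [/\ admissible R S Q' P' D', extends Q P D Q' P' D'
    & conn R Q' i (rectangle P' D') u v].
Proof.
move=> sysR sysS G.
have [p p0 bD] := cols_bound sysS j [:: u.2, v.2 & D].
pose D1 := [seq S j (- p + Z.of_nat k) | k <- iota 0 (Z.to_nat p).*2.+1].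
pose P1 := [:: u.1, v.1 & P].
have memD r : r \in [:: u.2, v.2 & D] -> r \in D1.
  move=> /bD [m mp ->]; apply/mapP; exists (Z.to_nat (m + p)).
    by rewrite mem_iota; lia.
  by congr (S j _); lia.
have sD : {subset D <= D1} by move=> r rD; apply: memD; rewrite !inE rD !orbT.
have sP : {subset P <= P1} by move=> r rP; rewrite !inE rP !orbT.
have G1 := admissible_enlarge sysR sysS sP sD G.
have [||Q' [P' [G' X' c]]] := 
  connect_rectangle sysR sysS i (j := j) (a := - p) (n := Z.to_nat p) G1.
- by move=> k kp; apply: map_f; rewrite mem_iota; lia.
- move=> r /mapP [k]; rewrite mem_iota => /andP [_ kp] ->; exists k => //; lia.
exists Q', P', D1; split=> //.
  exact: extends_trans (extends_enlarge _ sP sD) X'.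
by apply: c; split; rewrite ?memD // !inE eqxx ?orbT.
Qed.

(** * Switched colours decompose the product *)

Section Family.
Variables (I J : Type) (R : I -> Z -> nat) (S : J -> Z -> nat) (Q : square I J -> Prop).
Hypotheses (sysR : ray_system R) (sysS : ray_system S) (fam : square_family R S Q).
Implicit Types (i : I) (j : J) (x y : nat * nat).

Lemma row_adj_sound i x y : row_adj R Q i x y ->
  (x.2 = y.2 /\ ray_edge (R i) x.1 y.1) \/
  (x.1 = y.1 /\ exists j, ray_edge (S j) x.2 y.2).
Proof.
case=> [[e a _]|[q [Qq _ qx qy [e ne]]]]; [by left|right; split=> //].
exists (sq_j q); apply: (square_row_edge (q := flip q) (x := swap_pair x) (y := swap_pair y)) => //.
- exact: (family_col fam Qq).
- by apply/in_square_flip.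
- by apply/in_square_flip.
Qed.

Lemma row_edge_coloured i x y : x.2 = y.2 -> ray_edge (R i) x.1 y.1 ->
  row_adj R Q i x y \/ exists j, row_adj S (transpose Q) j (swap_pair x) (swap_pair y).
Proof.
move=> e a; have [[q [Qq qx qy]]|nq] :=
  pselect (exists q, [/\ Q q, in_square q x & in_square q y]).
  right; exists (sq_j q); right; exists (flip q).
  split; rewrite /transpose ?flipK //; try exact/in_square_flip.
  by split=> //; exact: (ray_edge_neq sysR a).
by left; left; split=> // q Qq qx qy; apply: nq; exists q.
Qed.

Lemma row_adj_inj i i' x y : row_adj R Q i x y -> row_adj R Q i' x y -> i = i'.
Proof.
case=> [[e a _]|[q [Qq <- qx qy [e ne]]]] [[e' a' _]|[q' [Qq' <- qx' qy' [e' ne']]]] //.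
- exact: (ray_disj sysR a a').
- by rewrite (family_disjoint fam Qq Qq' qx qx').
Qed.

Lemma row_adj_col_adj i j x y :
  row_adj R Q i x y -> ~ row_adj S (transpose Q) j (swap_pair x) (swap_pair y).
Proof.
case=> [[/= e a nq]|[q [/= Qq _ qx qy [e ne]]]]
  [[/= e' a' nq']|[q' [/= Qq' _ qx' qy' [e' ne']]]] //.
- by apply: (ray_edge_neq sysR a).
- rewrite -(flipK q') in qx' qy'.
  by apply: (nq _ Qq'); apply/in_square_flip; rewrite flipK in qx' qy' *.
- apply: (nq' (flip q)); rewrite /transpose ?flipK //; exact/in_square_flip.
Qed.

(** At a vertex outside the squares of colour i the neighbours are those in the
    row.  In such a square, which is unique, the neighbour in the row that belongs
    to the square is replaced by the vertical one. *)
Lemma row_adj_nbrs i x : exists y1 y2, y1 <> y2 /\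
  forall y, row_adj R Q i x y <-> y = y1 \/ y = y2.
Proof.
case: x => g r; have [m ->] := ray_surj sysR i g.
have nbr y : y.2 = r -> ray_edge (R i) (R i m) y.1 ->
    y = (R i (m - 1), r) \/ y = (R i (m + 1), r).
  case: y => y1 y2 /= -> [n [[/(ray_inj sysR) -> ->]|[-> /(ray_inj sysR) ->]]].
    by right.
  by left; congr (R i _, _); lia.
have edge b : ray_edge (R i) (R i m) (R i (m + side b 1)).
  by case: b; [exists m; left|exists (m - 1); right; split=> //; congr (R i _); lia].
have [[q [Qq qi qx]]|nq] := pselect (exists q, [/\ Q q, sq_i q = i & in_square q (R i m, r)]).
  have eQ q' : Q q' -> in_square q' (R i m, r) -> q' = q.
    by move=> Qq' qx'; exact: (family_disjoint fam Qq' Qq qx' qx).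
  (* The square continues to the side b and to the row r'. *)
    have [b [r' [nr qr qb]]] : exists b r', [/\ r <> r',
      (forall s, s = sq_h q \/ s = sq_h' q <-> s = r \/ s = r') &
      (forall n, R i n = sq_g q \/ R i n = sq_g' q <-> n = m \/ n = m + side b 1)].
    have [b qb] : exists b, forall n,
        R i n = sq_g q \/ R i n = sq_g' q <-> n = m \/ n = m + side b 1.
      have [n gn] : exists n, forall k, R i k = sq_g q \/ R i k = sq_g' q <-> k = n \/ k = n + 1.
        have := family_row fam Qq; rewrite qi => -[n [[-> ->]|[-> ->]]]; exists n => k;
          by split=> [[] /(ray_inj sysR)|[] ->]; auto.
      have /gn [en|en] := qx.1; first by exists true => k; rewrite gn /=; lia.
      by exists false => k; rewrite gn /=; lia.
    have nh := ray_edge_neq sysS (family_col fam Qq).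
    exists b; have [_ [] /= er] := qx; [exists (sq_h' q)|exists (sq_h q)];
      rewrite er; split=> //; first exact: nesym; tauto.
  exists (R i (m - side b 1), r), (R i m, r'); split; first by case.
  move=> y; split.
    case=> [[/= e a nq]|[q' [Qq' _ qx' qy' [/= e ne]]]].
      case: (nbr y) => //; case: (b) qb => /= qb ey; rewrite ey; try by left; congr (R i _, _); lia.
        case: (nq q Qq qx); rewrite ey; split=> /=; first by apply/qb; right.
        by apply/qr; left.
      case: (nq q Qq qx); rewrite ey; split=> /=; first by apply/qb; right; lia.
      by apply/qr; left.
    have eq' := eQ _ Qq' qx'; subst q'.
    by right; case: y e ne qy' => y1 y2 /= <- ne [_ /= /qr [e2|-> //]]; case: ne; rewrite e2.
  case=> ->; [left|right].
    split=> //=; first by have := edge (~~ b); case: (b).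
    move=> q' Qq' qx' [/= + _]; rewrite (eQ _ Qq' qx') => /qb.
    by case: (b) => /=; lia.
  exists q; split=> //; split=> /=; first by apply/qb; left.
  by apply/qr; right.
exists (R i (m - 1), r), (R i (m + 1), r); split.
  by case=> /(ray_inj sysR); lia.
move=> y; split=> [[[/= e a _]|[q [Qq qi qx _ _]]]|ey].
- exact: nbr.
- by case: nq; exists q.
left; have a : ray_edge (R i) (R i m) y.1.
  by case: ey => ->; [exact: (edge false)|exact: (edge true)].
have e : r = y.2 by case: ey => ->.
split=> // q Qq qx qy; apply: nq; exists q; split=> //.
apply: (ray_disj sysR _ a); apply: square_row_edge qx qy _; first exact: (family_row fam).
exact: (ray_edge_neq sysR a).
Qed.
End Family.

(** * The limit of the switchings *)

Section Limit.
Variables (I J : Type) (R : I -> Z -> nat) (S : J -> Z -> nat).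
Hypotheses (sysR : ray_system R) (sysS : ray_system S).

Definition state : Type :=
  {s : (square I J -> Prop) * (seq nat * seq nat) | admissible R S s.1 s.2.1 s.2.2}.

Definition connected_in (s : state) (c : I + J) (u v : nat * nat) : Prop :=
  let: (Q, (P, D)) := sval s in
  match c with
  | inl i => conn R Q i (rectangle P D) u v
  | inr j => conn S (transpose Q) j (rectangle D P) u v
  end.

Definition state_le (s s' : state) : Prop :=
  extends (sval s).1 (sval s).2.1 (sval s).2.2 (sval s').1 (sval s').2.1 (sval s').2.2.

Lemma state_connect (i0 : I) (j0 : J) (s : state) c u v :
  exists s', state_le s s' /\ connected_in s' c u v.
Proof.
case: s => -[Q [P D]] /= G; case: c => [i|j].
  have [Q' [P' [D' [G' X' c]]]] := connect_points j0 i u v sysR sysS G.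
  by exists (exist _ (Q', (P', D')) G').
have [Q' [D' [P' [G' X' c]]]] := connect_points i0 j u v sysS sysR (admissible_transpose G).
have G'' := admissible_transpose G'.
exists (exist _ (transpose Q', (P', D')) G''); split; last by rewrite /connected_in /= transposeK.
by apply: extends_transpose; rewrite /= transposeK.
Qed.

Lemma admissible_empty : admissible R S (fun=> False) [::] [::].
Proof.
have wirable0 (I' J' : Type) (R' : I' -> Z -> nat) i : @wirable I' J' R' (fun=> False) [::] [::] i.
  by exists 0, id; split=> // x [].
by split=> //; split.
Qed.

Lemma rst_rt T (r : T -> T -> Prop) x y : (forall a b, r a b -> r b a) ->
  clos_refl_sym_trans T r x y -> clos_refl_trans T r x y.
Proof.
move=> sym; elim=> [a b ab|a|a b _ ba|a b c _ ab _ bc].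
- exact: rt_step.
- exact: rt_refl.
- elim: ba => [c d /sym|c|c d e _ dc _ ed]; [exact: rt_step|exact: rt_refl|exact: rt_trans ed dc].
- exact: rt_trans bc.
Qed.

(** A frozen connection survives: an edge of the row colour in P x D that is in no
    square of [Q] is in no later square either. *)
Lemma conn_row_adj (I' J' : Type) (R' : I' -> Z -> nat) (Q Q' : square I' J' -> Prop) i P D u v :
  (forall q, Q q -> Q' q) ->
  (forall q x, Q' q -> in_square q x -> x.1 \in P -> x.2 \in D -> Q q) ->
  conn R' Q i (rectangle P D) u v -> clos_refl_trans _ (row_adj R' Q' i) u v.
Proof.
move=> sQ new c; apply: rst_rt => [a b|]; first exact: row_adj_sym.
elim: c => [a b [ab [aP aD] _]|a|a b _ ba|a b c _ ab _ bc].
- apply: rst_step; case: ab => [[e ed nq]|[q [Qq qi qa qb e]]]; [left|right].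
    split=> // q Qq qa; exact: nq (new _ _ Qq qa aP aD) qa.
  by exists q; split=> //; exact: sQ.
- exact: rst_refl.
- exact: rst_sym.
- exact: rst_trans bc.
Qed.

(** Every task is the value of [task] at some n, and is served at step n + 1. *)
Lemma limit_family (c : nat -> I + J) (i0 : I) (j0 : J) :
  (forall x, exists n, c n = x) ->
  exists Q : square I J -> Prop, [/\ square_family R S Q,
    forall i u v, clos_refl_trans _ (row_adj R Q i) u v &
    forall j u v, clos_refl_trans _ (row_adj S (transpose Q) j) u v].
Proof.
move=> c_surj.
pose task n := odflt (0%N, ((0%N, 0%N), (0%N, 0%N)))
  (unpickle n : option (nat * ((nat * nat) * (nat * nat)))).
have /choice [next nextP] (x : state * nat) : exists s', state_le x.1 s' /\
    connected_in s' (c (task x.2).1) (task x.2).2.1 (task x.2).2.2.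
  exact: state_connect.
pose s := fix s n : state :=
  if n is n.+1 then next (s n, n) else exist _ (_, (_, _)) admissible_empty.
have s_le m n : (m <= n)%N -> state_le (s m) (s n).
  elim: n => [|n IHn]; first by rewrite leqn0 => /eqP ->; exact: extends_refl.
  rewrite leq_eqVlt => /orP [/eqP ->|/IHn le]; first exact: extends_refl.
  exact: extends_trans le (nextP (s n, n)).1.
pose Q q := exists n, (sval (s n)).1 q.
have sQ n q : (sval (s n)).1 q -> Q q by exists n.
have new n q x : Q q -> in_square q x -> x.1 \in (sval (s n)).2.1 ->
    x.2 \in (sval (s n)).2.2 -> (sval (s n)).1 q.
  move=> [m Qq]; have [le|/ltnW le] := leqP m n.
    by have [_ _ + _] := s_le _ _ le => /(_ q Qq).
  by have [_ _ _] := s_le _ _ le; exact.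
have fam n := admissible_family (svalP (s n)).
have done_task x u v : exists n, connected_in (s n) x u v.
  have [k <-] := c_surj x; pose n := pickle (k, (u, v)).
  exists n.+1; have := (nextP (s n, n)).2; by rewrite /= /task pickleK.
exists Q; split.
- split=> [q [n /(family_row (fam n)) //]|q [n /(family_col (fam n)) //]|].
  move=> q q' x [m Qq] [n Qq'].
  have [_ _ Qm _] := s_le _ _ (leq_maxl m n); have [_ _ Qn _] := s_le _ _ (leq_maxr m n).
  exact: (family_disjoint (fam (maxn m n))) (Qm _ Qq) (Qn _ Qq').
- move=> i u v; have [n] := done_task (inl i) u v; rewrite /connected_in.
  move: (sQ n) (new n); case: (sval (s n)) => Qn [P D] /= sQn newn.
  exact: conn_row_adj.
- move=> j u v; have [n] := done_task (inr j) u v; rewrite /connected_in.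
  move: (sQ n) (new n); case: (sval (s n)) => Qn [P D] /= sQn newn.
  apply: conn_row_adj => [q|q x Qq qx xD xP]; first exact: sQn.
  by apply: (newn _ (swap_pair x) Qq) => //; apply/in_square_flip.
Qed.
End Limit.

(** * Parametrising double rays by the integers *)

Local Open Scope classical_set_scope.
Local Open Scope card_scope.

Lemma card2P T (A : set T) :
  A #= `I_2 <-> exists y1 y2, y1 <> y2 /\ forall y, A y <-> y = y1 \/ y = y2.
Proof.
split=> [/card_set_bijP [f [fA finj fsurj]]|[y1 [y2 [ne AE]]]].
  have [y1 Ay1 f1] := fsurj 0%N isT; have [y2 Ay2 f2] := fsurj 1%N isT.
  exists y1, y2; split=> [e|y]; first by move: f1; rewrite e f2.
  split=> [Ay|[]-> //].
  have := fA y Ay; case fy: (f y) => [|[|]] //= _; [left|right];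
    by apply: finj; rewrite ?inE // fy.
apply/card_set_bijP; exists (fun y => if pselect (y = y1) then 0%N else 1%N).
split.
- by move=> y _ /=; case: pselect.
- move=> y z; rewrite !inE => /AE [] -> /AE [] ->; case: pselect => //; case: pselect => //.
- move=> [|[|]] //= _; [exists y1; first (by apply/AE; left)|exists y2; first (by apply/AE; right)].
    by case: pselect.
  by case: pselect => // e; case: ne.
Qed.

Section DoubleRay.
Variables (T : Type) (D : graph T).
Hypothesis rayD : double_ray D.

Lemma double_ray_nbrs x : vertices D x ->
  exists y1 y2, y1 <> y2 /\ forall y, adj D x y <-> y = y1 \/ y = y2.
Proof. by move=> Vx; have [_ _ reg] := rayD; exact/card2P/reg. Qed.

Lemma third_nbr x a b c : adj D x a -> adj D x b -> adj D x c -> a <> b ->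
  c = a \/ c = b.
Proof.
move=> xa; have [/double_ray_nbrs [y1 [y2 [_ N]]] _] := adj_vertices xa.
move: xa => /N + /N + /N; intuition congruence.
Qed.

Lemma other_nbr x y : adj D x y -> exists z, adj D x z /\ z <> y.
Proof.
move=> xy; have [/double_ray_nbrs [y1 [y2 [ne N]]] _] := adj_vertices xy.
have [e|ney] := pselect (y1 = y); last by exists y1; split=> //; apply/N; left.
by exists y2; split; [apply/N; right|move=> e'; apply: ne; rewrite e e'].
Qed.

(** In a 2-regular graph an arc (x, y) has a unique continuation (y, z) with z
    different from x; iterating it gives the walk. *)
Lemma nonbacktracking_walk x y : adj D x y -> exists f : nat -> T,
  [/\ f 0%N = x, f 1%N = y, forall n, adj D (f n) (f n.+1)
    & forall n, f n.+2 <> f n].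
Proof.
move=> xy.
have /choice [next nextP] (p : {p : T * T | adj D p.1 p.2}) :
    exists p' : {p : T * T | adj D p.1 p.2},
      (sval p').1 = (sval p).2 /\ (sval p').2 <> (sval p).1.
  case: p => -[a b] /= ab; have [z [bz ne]] := other_nbr (adj_sym ab).
  by exists (exist _ (b, z) bz).
pose p n := iter n next (exist _ (x, y) xy).
have pS n : (sval (p n.+1)).1 = (sval (p n)).2 by exact: (nextP (p n)).1.
exists (fun n => (sval (p n)).1); split=> // n.
- by rewrite pS; exact: (svalP (p n)).
- by rewrite pS; exact: (nextP (p n)).2.
Qed.

Lemma double_ray_walk : exists w : Z -> T,
  (forall m, adj D (w m) (w (m + 1)%Z)) /\ (forall m, w (m - 1)%Z <> w (m + 1)%Z).
Proof.
have [inf _ _] := rayD; have [x Vx] : exists x, vertices D x.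
  apply: contrapT => none; apply: inf.
  rewrite (_ : vertices D = set0); first exact: finite_set0.
  by apply/seteqP; split=> // x Vx; apply: none; exists x.
have [a [b [ab N]]] := double_ray_nbrs Vx.
have xa : adj D x a by apply/N; left.
have xb : adj D x b by apply/N; right.
have [f [f0 f1 fadj fne]] := nonbacktracking_walk xa.
have [g [g0 g1 gadj gne]] := nonbacktracking_walk xb.
pose w m := if (0 <=? m)%Z then f (Z.to_nat m) else g (Z.to_nat (- m)).
have wf n : w (Z.of_nat n) = f n.
  by rewrite /w; case: Z.leb_spec => [_|]; [congr f|]; lia.
have wg n : w (- Z.of_nat n)%Z = g n.
  rewrite /w; case: Z.leb_spec => [n0|_]; last by congr g; lia.
  by have -> : n = 0%N; [lia|rewrite /= f0 g0].
have Zcase m : (exists n, m = Z.of_nat n.+1) \/ m = 0%Z \/ exists n, m = (- Z.of_nat n.+1)%Z.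
  case: (Z.lt_trichotomy m 0) => [|[]] m0; [right; right|by right; left|left].
    by exists (Z.to_nat (- m)).-1; lia.
  by exists (Z.to_nat m).-1; lia.
exists w; split=> m; case: (Zcase m) => [[n ->]|[->|[n ->]]].
- by rewrite (_ : _ + 1 = Z.of_nat n.+2)%Z ?wf; [exact: fadj|lia].
- by rewrite (wf 0%N) (wf 1%N); exact: fadj.
- by rewrite (_ : _ + 1 = - Z.of_nat n)%Z ?wg; [exact/adj_sym/gadj|lia].
- rewrite (_ : _ + 1 = Z.of_nat n.+2)%Z; last by lia.
  by rewrite (_ : _ - 1 = Z.of_nat n)%Z ?wf; [exact/nesym/fne|lia].
- by rewrite (wf 1%N) (wg 1%N) f1 g1; exact: nesym.
- rewrite (_ : _ + 1 = - Z.of_nat n)%Z; last by lia.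
  by rewrite (_ : _ - 1 = - Z.of_nat n.+2)%Z ?wg; [exact: gne|lia].
Qed.

(** The walk visits a set closed under adjacency, hence all vertices.  If it came
    back to a vertex, it would either go on as before, and its range would be
    finite, or go back the same way, and it would turn round in the middle of a
    segment, at a vertex or in an edge. *)
Lemma double_ray_parametrization : exists w : Z -> T,
  [/\ injective w, forall x, vertices D x <-> exists m, x = w m
    & forall x y, adj D x y <->
        exists m, (x = w m /\ y = w (m + 1)%Z) \/ (y = w m /\ x = w (m + 1)%Z)].
Proof.
have [w [wadj wne]] := double_ray_walk.
have [inf con _] := rayD.
have wV m : vertices D (w m) by have [] := adj_vertices (wadj m).
have wadj' m : adj D (w m) (w (m - 1)%Z).
  by apply: adj_sym; have := wadj (m - 1)%Z; rewrite Z.sub_add.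
have nbr m y : adj D (w m) y -> y = w (m - 1)%Z \/ y = w (m + 1)%Z.
  by move=> my; exact: third_nbr (wadj' m) (wadj m) my (@wne m).
have closed_all (A : set T) : (exists m, A (w m)) ->
    (forall x y, A x -> adj D x y -> A y) -> forall x, vertices D x -> A x.
  move=> [m Am] clA x Vx; have := con _ _ (wV m) Vx.
  by move: (w m) Am => u Au c; elim: c Au => [a b ab /clA|//|a b c _ ab _ bc /ab/bc //]; exact.
have surj x : vertices D x -> exists m, x = w m.
  apply: (closed_all [set x | exists m, x = w m]); first by exists 0%Z, 0%Z.
  by move=> _ y [m ->] /nbr [] ->; [exists (m - 1)%Z|exists (m + 1)%Z].
have no_return m n : (m < n)%Z -> w m <> w n.
  move=> mn e.
  have wn1 : adj D (w m) (w (n - 1)%Z) by rewrite e.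
  have wn2 : adj D (w m) (w (n + 1)%Z) by rewrite e.
  have [e1|e1] := nbr _ _ wn1.
  - (* The vertices visited between m and n are closed under adjacency. *)
    pose A := [set x | exists2 k, (m <= k < n)%Z & x = w k].
    apply: inf; apply: (sub_finite_set (B := A)).
      apply: closed_all; first by exists m; exists m => //; lia.
      move=> _ y [k mk ->] /nbr [] ->.
        have [->|ne] := Z.eq_dec k m; first by rewrite -e1; exists (n - 1)%Z => //; lia.
        by exists (k - 1)%Z => //; lia.
      have [->|ne] := Z.eq_dec k (n - 1)%Z; last by exists (k + 1)%Z => //; lia.
      by rewrite Z.sub_add -e; exists m => //; lia.
    apply: (sub_finite_set (B := (fun k => w (m + Z.of_nat k)%Z) @` `I_(Z.to_nat (n - m)))).
      move=> _ [k mk ->]; exists (Z.to_nat (k - m)); first by rewrite /=; lia.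
      by congr w; lia.
    exact/finite_image/finite_II.
  - (* The walk is reflected about the middle of m and n. *)
    have refl k : w (m + Z.of_nat k)%Z = w (n - Z.of_nat k)%Z /\
        w (m + Z.of_nat k.+1)%Z = w (n - Z.of_nat k.+1)%Z.
      elim: k => [|k [IH1 IH2]]; first by rewrite Z.add_0_r Z.sub_0_r.
      split=> //.
      have a : adj D (w (m + Z.of_nat k.+1)%Z) (w (n - Z.of_nat k.+2)%Z).
        rewrite IH2; have := wadj' (n - Z.of_nat k.+1)%Z.
        by rewrite (_ : _ - _ - 1 = n - Z.of_nat k.+2)%Z //; lia.
      have [e2|->] := nbr _ _ a; last by congr w; lia.
      case: (@wne (n - Z.of_nat k.+1)%Z).
      rewrite (_ : _ - 1 = n - Z.of_nat k.+2)%Z; last by lia.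
      rewrite e2 (_ : _ - 1 = m + Z.of_nat k)%Z; last by lia.
      by rewrite IH1; congr w; lia.
    have [c [ec|ec]] : exists c, (n - m = 2 * Z.of_nat c + 2 \/ n - m = 2 * Z.of_nat c + 1)%Z.
      have := Z.div_mod (n - m - 1) 2; have := Z.mod_pos_bound (n - m - 1) 2.
      by exists (Z.to_nat ((n - m - 1) / 2)); lia.
    + have [r _] := refl c; apply: (@wne (m + Z.of_nat c + 1)%Z).
      rewrite Z.add_simpl_r r; congr w; lia.
    + have [r _] := refl c; apply: (@adj_irrefl _ D (w (m + Z.of_nat c)%Z)).
      by rewrite {2}r (_ : n - _ = m + Z.of_nat c + 1)%Z //; lia.
exists w; split.
- move=> m n e; case: (Z.lt_trichotomy m n) => [/no_return|[//|/no_return]] //.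
  by rewrite e.
- by move=> x; split=> [/surj //|[m ->]].
- move=> x y; split=> [xy|[m [[-> ->]|[-> ->]]]]; last exact/adj_sym/wadj.
    have [/surj [m ex] _] := adj_vertices xy; rewrite {x}ex in xy *.
    by have [->|->] := nbr _ _ xy; [exists (m - 1)%Z; right; rewrite Z.sub_add|exists m; left].
  exact: wadj.
Qed.
End DoubleRay.

(** * Decompositions as ray systems, and the product *)

(** Each ray contains an edge at the vertex 0, and different rays lead to different
    neighbours of 0. *)
Lemma ray_system_enumerable I (R : I -> Z -> nat) (i0 : I) : ray_system R ->
  exists e : nat -> I, forall i, exists n, e n = i.
Proof.
move=> sysR.
have /choice [e eP] n : exists i, forall i', ray_edge (R i') 0%N n -> i' = i.
  have [[i a]|none] := pselect (exists i, ray_edge (R i) 0%N n).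
    by exists i => i' a'; exact: (ray_disj sysR a' a).
  by exists i0 => i' a; case: none; exists i'.
exists e => i; have [m em] := ray_surj sysR i 0%N.
by exists (R i (m + 1)); apply/esym/eP; exists m; left.
Qed.

Section Grid.
Variables (I J : Type) (R : I -> Z -> nat) (S : J -> Z -> nat).
Hypotheses (sysR : ray_system R) (sysS : ray_system S).

Lemma grid_colouring (i0 : I) (j0 : J) :
  exists A : I + J -> nat * nat -> nat * nat -> Prop,
  [/\ forall c x y, A c x y -> A c y x,
      forall c c' x y, A c x y -> A c' x y -> c = c',
      forall c x, exists y1 y2, y1 <> y2 /\ forall y, A c x y <-> y = y1 \/ y = y2,
      forall c x y, clos_refl_trans _ (A c) x y
    & forall x y, (exists c, A c x y) <->
        (x.2 = y.2 /\ exists i, ray_edge (R i) x.1 y.1) \/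
        (x.1 = y.1 /\ exists j, ray_edge (S j) x.2 y.2)].
Proof.
have [eI eIP] := ray_system_enumerable i0 sysR.
have [eJ eJP] := ray_system_enumerable j0 sysS.
pose e n := if odd n then inl (eI n./2) else inr (eJ n./2).
have [|Q [fam rows cols]] := limit_family sysR sysS (c := e) i0 j0.
  move=> [i|j].
    by have [n en] := eIP i; exists n.*2.+1; rewrite /e /= odd_double /= uphalf_double en.
  by have [n en] := eJP j; exists n.*2; rewrite /e odd_double doubleK en.
have fam' := square_family_transpose fam.
have swapK : forall x : nat * nat, swap_pair (swap_pair x) = x by case.
exists (fun c x y => match c with
  | inl i => row_adj R Q i x y
  | inr j => row_adj S (transpose Q) j (swap_pair x) (swap_pair y) end).
split.
- by move=> [i|j] x y; exact: row_adj_sym.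
- move=> [i|j] [i'|j'] x y a a'.
  + by rewrite (row_adj_inj sysR fam a a').
  + by case: (row_adj_col_adj sysR a a').
  + by case: (row_adj_col_adj sysR a' a).
  + by rewrite (row_adj_inj sysS fam' a a').
- move=> [i|j] x; first exact: (row_adj_nbrs sysR sysS fam).
  have [y1 [y2 [ne N]]] := row_adj_nbrs sysS sysR fam' j (swap_pair x).
  exists (swap_pair y1), (swap_pair y2); split=> [/(congr1 swap_pair)|y].
    by rewrite !swapK.
  by rewrite N; split=> -[E|E]; [left; rewrite -E|right; rewrite -E|left; rewrite E|right; rewrite E];
    rewrite swapK.
- move=> [i|j] x y; first exact: rows.
  rewrite -(swapK x) -(swapK y); have := cols j (swap_pair x) (swap_pair y).
  elim=> [a b ab|a|a b c _ ab _ bc]; last exact: rt_trans bc.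
    by apply: rt_step; rewrite !swapK.
  exact: rt_refl.
- move=> x y; split=> [[[i|j] a]|[[e1 [i a]]|[e1 [j a]]]].
  + have [[e1 a1]|[e1 a1]] := row_adj_sound fam a; [left|right] => //.
    by split=> //; exists i.
  + have [[e1 a1]|[e1 [i a1]]] := row_adj_sound fam' a; [right|left].
      by split=> //; exists j.
    by split=> //; exists i.
  + have [a'|[j a']] := row_edge_coloured S Q sysR e1 a; first by exists (inl i).
    by exists (inr j).
  + have [a'|[i a']] := row_edge_coloured R (transpose Q) sysS
        (x := swap_pair x) (y := swap_pair y) e1 a; first by exists (inr j).
    by exists (inl i); rewrite transposeK !swapK in a'.
Qed.
End Grid.

Local Open Scope classical_set_scope.

Lemma set2_eq T (a b c d : T) : [set a; b] = [set c; d] ->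
  (a = c /\ b = d) \/ (a = d /\ b = c).
Proof.
move=> e.
have ha : [set c; d] a by rewrite -e; left.
have hb : [set c; d] b by rewrite -e; right.
have hc : [set a; b] c by rewrite e; left.
have hd : [set a; b] d by rewrite e; right.
by case: ha hb hc hd => /= ? [] /= ? [] /= ? [] /= ?; intuition congruence.
Qed.

Lemma edges_pair T (D : graph T) x y : edges D [set x; y] <-> adj D x y.
Proof.
split=> [[a [b [ab e]]]|xy]; last by exists x, y.
by have [[-> ->]|[-> ->]] := set2_eq e; last exact: adj_sym.
Qed.

(** A Hamilton decomposition of a countable graph, with the vertices renamed by the
    natural numbers. *)
Lemma hamilton_ray_system T (G : graph T) :
  countably_infinite G -> has_hamilton_decomposition G ->
  exists (phi : nat -> T) (I : Type) (i0 : I) (R : I -> Z -> nat),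
  [/\ injective phi, forall x, vertices G x <-> exists n, x = phi n,
      ray_system R
    & forall a b, adj G (phi a) (phi b) <-> exists i, ray_edge (R i) a b].
Proof.
move=> /card_set_bijP [f [_ finj fsurj]] [F [[D0 FD0] hamF [covF disjF _]]].
have /choice [phi phiP] n : exists x, vertices G x /\ f x = n.
  by have [x Vx fx] := fsurj n I; exists x.
have phiV x : vertices G x <-> exists n, x = phi n.
  split=> [Vx|[n ->]]; last exact: (phiP n).1.
  exists (f x); apply: finj; rewrite ?inE //; first exact: (phiP _).1.
  by rewrite (phiP _).2.
have phi_inj : injective phi by apply: (can_inj (g := f)) => n; exact: (phiP n).2.
have /choice [R RP] (D : {D | F D}) : exists r : Z -> nat,
    [/\ injective r, forall n, exists m, n = r m
      & forall a b, adj (sval D) (phi a) (phi b) <-> ray_edge r a b].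
  case: D => D /= /hamF [rayD _ VD].
  have [w [winj wV wadj]] := double_ray_parametrization rayD.
  have /choice [r rP] m : exists n, w m = phi n.
    by apply/phiV; rewrite -VD; apply/wV; exists m.
  exists r; split.
  - by move=> m n e; apply: winj; rewrite !rP e.
  - move=> n; have /wV [m em] : vertices D (phi n) by rewrite VD; apply/phiV; exists n.
    by exists m; apply: phi_inj; rewrite em rP.
  - move=> a b; split=> [/wadj|[m ab]].
      by move=> [m]; rewrite !rP => -[[/phi_inj -> /phi_inj ->]|[/phi_inj -> /phi_inj ->]];
        exists m; [left|right].
    by apply/wadj; exists m; case: ab => -[-> ->]; [left|right]; rewrite !rP.
exists phi, {D | F D}, (exist _ D0 FD0), R; split=> //.
- split=> [D|D|D D' a b].
  + by have [] := RP D.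
  + by have [] := RP D.
  + have [_ _ <-] := RP D; have [_ _ <-] := RP D'.
    case: D D' => [D FD] [D' FD'] /= ab ab'; apply: eq_exist.
    by apply: disjF => //; exists [set phi a; phi b]; split; apply/edges_pair.
- move=> a b; rewrite -edges_pair -covF; split=> [[D FD /edges_pair ab]|[D]].
    by exists (exist _ D FD); have [_ _ <-] := RP (exist _ D FD).
  have [_ _ <-] := RP D => ab; exists (sval D); first exact: (svalP D).
  exact/edges_pair.
Qed.

Theorem theorem1p2 (T U : Type) (G : graph T) (H : graph U)
    (cG : countably_infinite G) (cH : countably_infinite H)
    (dG : has_hamilton_decomposition G) (dH : has_hamilton_decomposition H) :
  has_hamilton_decomposition (cartesian_product G H).
Proof.
have [phi [I [i0 [R [phi_inj phiV sysR adjG]]]]] := hamilton_ray_system cG dG.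
have [psi [J [j0 [S [psi_inj psiV sysS adjH]]]]] := hamilton_ray_system cH dH.
have [A [Asym Ainj Anbrs Acon Aadj]] := grid_colouring sysR sysS i0 j0.
pose Phi (x : nat * nat) := (phi x.1, psi x.2).
have Phi_inj : injective Phi by move=> [a b] [c d] [/phi_inj -> /psi_inj ->].
have PhiV p : cart_vertices G H p <-> exists x, p = Phi x.
  case: p => g h; split=> [[/= /phiV [a ->] /psiV [b ->]]|[[a b] [-> ->]]].
    by exists (a, b).
  by split; [apply/phiV; exists a|apply/psiV; exists b].
have PhiA x y : cart_adj G H (Phi x) (Phi y) <-> exists c, A c x y.
  rewrite Aadj; split=> [[] [_ /=]|[[e [i a]]|[e [j a]]]].
  - by move=> /phi_inj e /adjH a; right.
  - by move=> /psi_inj e /adjG a; left.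
  - by right; split; [apply/psiV; exists x.2|rewrite /= e|apply/adjG; exists i].
  - by left; split; [apply/phiV; exists x.1|rewrite /= e|apply/adjH; exists j].
pose B c p q := exists x y, [/\ p = Phi x, q = Phi y & A c x y].
have BPhi c x y : B c (Phi x) (Phi y) <-> A c x y.
  split=> [[a [b [/Phi_inj -> /Phi_inj ->]]] //|a]; by exists x, y.
have BV c p q : B c p q -> cart_vertices G H p /\ cart_vertices G H q.
  by move=> [x [y [-> -> _]]]; split; apply/PhiV; [exists x|exists y].
have Bsym c p q : B c p q -> B c q p.
  by move=> [x [y [-> -> /Asym a]]]; exists y, x.
have Birr c p : ~ B c p p.
  move=> [x [y [-> /Phi_inj -> a]]].
  have /PhiA : exists c, A c y y by exists c.
  exact: cart_adj_irrefl.
pose D c := Graph (@BV c) (@Bsym c) (@Birr c).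
have disjD c c' : edges (D c) `&` edges (D c') !=set0 -> c = c'.
  move=> [_ [[_ [_ [[x [y [-> -> a]]] ->]]]]] /edges_pair /BPhi; exact: Ainj.
have [_ /PhiV [x0 _]] : True /\ cart_vertices G H (phi 0%N, psi 0%N).
  by split=> //; apply/PhiV; exists (0%N, 0%N).
have edgeD c : exists p q, B c p q.
  have [y1 [y2 [_ N]]] := Anbrs c x0.
  by exists (Phi x0), (Phi y1); apply/BPhi/N; left.
exists (range D); split.
- by exists (D (inl i0)), (inl i0).
- move=> _ [c _ <-]; split=> //; last first.
    split=> // _ [_ [_ [[x [y [-> -> a]]] ->]]].
    by apply/edges_pair/PhiA; exists c.
  split.
  + move=> fin.
    have [g [_ _ gsurj]] := card_set_bijP cG.
    have : finite_set [set: nat].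
      apply: (sub_finite_set (B := (fun p => g p.1) @` cart_vertices G H)).
        move=> n _; have [x Vx gx] := gsurj n Logic.I.
        by exists (x, psi 0%N) => //; split=> //; apply/psiV; exists 0%N.
      exact: finite_image.
    exact: infinite_nat.
  + move=> p q /PhiV [x ->] /PhiV [y ->].
    elim: (Acon c x y) => [a b ab|a|a b d _ ab _ bd]; last exact: rt_trans bd.
      by apply: rt_step; apply/BPhi.
    exact: rt_refl.
  + move=> p /PhiV [x ->]; apply/card2P.
    have [y1 [y2 [ne N]]] := Anbrs c x; exists (Phi y1), (Phi y2).
    split=> [/Phi_inj //|q]; split=> [[a [b [/Phi_inj <- -> /N]]]|].
      by case=> ->; auto.
    by case=> ->; apply/BPhi/N; auto.
- split.
  + apply/seteqP; split=> [e [_ [c _ <-]] [_ [_ [[x [y [-> -> a]]] ->]]]|_ [p [q [pq ->]]]].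
      by apply/edges_pair/PhiA; exists c.
    have [/PhiV [x ex] /PhiV [y ey]] := cart_adj_vertices pq.
    rewrite {}ex {}ey in pq *; have /PhiA [c a] := pq.
    by exists (D c); [exists c|apply/edges_pair/BPhi].
  + by move=> _ _ [c _ <-] [c' _ <-] /disjD ->.
  + move=> _ [c _ <-]; have [p [q pq]] := edgeD c.
    by exists [set p; q]; apply/edges_pair.
Qed.
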